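(* Let $\alpha\in\mathbb{R}$ with $\alpha\neq 0$. The complex operator ideal $\mathfrak{C}_\alpha:=\{T : T \text{ admits a factorization over the space } Z_\alpha\}$ is not self conjugate, i.e. $\mathfrak{C}_\alpha\neq\overline{\mathfrak{C}_\alpha}$.
   Context: Let $f_\alpha(t):=t^{1+i\alpha}$ for $0\le t<\infty$. For a complex sequence $x=(\xi_k)\in \ell_2$ define $\Omega_\alpha(x)$ by $(\Omega_\alpha(x))_k:=\xi_k f_\alpha\left(\log \frac{\|x\|_2}{|\xi_k|}\right)$ if $\xi_k\neq 0$ and $0$ otherwise. Let $Z_\alpha$ be the space of all pairs $(x,y)$ of complex-valued sequences with $x\in\ell_2$ such that $\|(x,y)\|_\alpha:=\|x\|_2+\|y-\Omega_\alpha(x)\|_2<\infty$; it is known (Kalton) that $\|\cdot\|_\alpha$ is equivalent to a norm under which $Z_\alpha$ is a complex Banach space. A bounded linear operator $T:X\to Y$ between complex Banach spaces admits a factorization over $Z_\alpha$ if $T=BA$ for some bounded linear operators $A:X\to Z_\alpha$ and $B:Z_\alpha\to Y$. For a complex Banach space $X$, its complex conjugate $\overline X$ is the set $X$ with the same norm and addition but scalar multiplication $\lambda\odot x:=\overline{\lambda}x$; for an operator $T:X\to Y$, $\overline T$ denotes the same map regarded as an (again linear) operator $\overline X\to\overline Y$. For a complex operator ideal $\mathfrak{C}$, the conjugate ideal $\overline{\mathfrak{C}}$ consists of all operators $T:X\to Y$ such that $\overline T\in\mathfrak{C}(\overline X,\overline Y)$; $\mathfrak{C}$ is called self conjugate if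 $\mathfrak{C}=\overline{\mathfrak{C}}$. *)

(* Defs.v *)
From HB Require Import structures.
From mathcomp Require Import all_boot all_order all_algebra.
From mathcomp Require Import all_classical all_reals all_analysis.
From mathcomp Require Import complex.
Set Implicit Arguments. Unset Strict Implicit. Unset Printing Implicit Defensive.
Import Order.TTheory GRing.Theory Num.Theory.
Local Open Scope ring_scope.
Local Open Scope complex_scope.

Section Kalton.
Variable R : realType.
Local Notation C := R[i].

Definition cabs (z : C) : R := Num.sqrt (complex.Re z ^+ 2 + complex.Im z ^+ 2).

Definition sqsum (x : nat -> C) : \bar R :=
  (\sum_(k <oo) ((cabs (x k)) ^+ 2)%:E)%E.

Definition in_l2 (x : nat -> C) : Prop := (sqsum x < +oo)%E.

Definition l2norm (x : nat -> C) : R := Num.sqrt (fine (sqsum x)).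

(* f_alpha(t) = t^{1 + i alpha} = t * exp(i alpha log t), t >= 0
   (value 0 at t = 0) *)
Definition f_alpha (alpha t : R) : C :=
  t%:C * (cos (alpha * ln t) +i* sin (alpha * ln t)).

Definition Omega (alpha : R) (x : nat -> C) : nat -> C :=
  fun k => if x k == 0 then 0
           else x k * f_alpha alpha (ln (l2norm x / cabs (x k))).

Definition seqpair := ((nat -> C) * (nat -> C))%type.

Definition pair_add (z w : seqpair) : seqpair :=
  (fun k => z.1 k + w.1 k, fun k => z.2 k + w.2 k).
Definition pair_scale (a : C) (z : seqpair) : seqpair :=
  (fun k => a * z.1 k, fun k => a * z.2 k).

Definition in_Z (alpha : R) (z : seqpair) : Prop :=
  in_l2 z.1 /\ in_l2 (fun k => z.2 k - Omega alpha z.1 k).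

(* the quasi-norm ||(x,y)||_alpha = ||x||_2 + ||y - Omega_alpha(x)||_2
   (equivalent to a norm on Z_alpha, so boundedness may be tested with it) *)
Definition Znorm (alpha : R) (z : seqpair) : R :=
  l2norm z.1 + l2norm (fun k => z.2 k - Omega alpha z.1 k).

(* Scalar twist: [tw false] is the identity (usual scalar multiplication),
   [tw true] is complex conjugation (scalar multiplication of the complex
   conjugate space, lambda (.) x := conj(lambda) x). *)
Definition tw (b : bool) (a : C) : C := if b then a^* else a.

Definition bounded_linear (X Y : normedModType C) (T : X -> Y) : Prop :=
  (forall (a : C) (x y : X), T (a *: x + y) = a *: T x + T y) /\
  exists M : C, forall x : X, `|T x| <= M * `|x|.

(* T = B A with A : X^b -> Z_alpha and B : Z_alpha -> Y^b bounded linear,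
   where X^b is X if b = false and the complex conjugate space of X if
   b = true (same set, addition and norm; scalar action a (.) x = a^* x).
   Linearity of A : conj X -> Z_alpha reads A(a (.) x + y) = a A x + A y,
   i.e. A (tw b a *: x + y) = a A x + A y; linearity of
   B : Z_alpha -> conj Y reads B(a z + w) = a (.) B z + B w. *)
Definition factors_Z (alpha : R) (b : bool) (X Y : normedModType C)
    (T : X -> Y) : Prop :=
  exists (A : X -> seqpair) (B : seqpair -> Y),
    [/\ (forall x, in_Z alpha (A x)),
        (forall (a : C) (x y : X),
            A (tw b a *: x + y) = pair_add (pair_scale a (A x)) (A y)),
        (exists M : C, forall x : X, (Znorm alpha (A x))%:C <= M * `|x|) &
        [/\ (forall (a : C) (z w : seqpair), in_Z alpha z -> in_Z alpha w ->
            B (pair_add (pair_scale a z) w) = tw b a *: B z + B w),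
        (exists M : C, forall z, in_Z alpha z ->
            `|B z| <= M * (Znorm alpha z)%:C) &
        (forall x : X, T x = B (A x))]].

Definition in_C_alpha (alpha : R) (X Y : completeNormedModType C)
  (T : X -> Y) : Prop := factors_Z alpha false T.

(* The conjugate class: T in conj(C_alpha) iff conj T : conj X -> conj Y
   factors over Z_alpha.  Since conj T is the same map, and a map
   conj X -> Z_alpha is linear iff it is conjugate-linear X -> Z_alpha,
   this unfolds to [factors_Z alpha true T]. *)
Definition in_conj_C_alpha (alpha : R) (X Y : completeNormedModType C)
  (T : X -> Y) : Prop := factors_Z alpha true T.

End Kalton.

(* Main.v *)
(* Take [T] to be the identity of [Z_alpha], renormed as a Banach space by duality: the pairing of
   [(x, y)] with [(v - Omega w, w)] is bounded because [f_alpha] is Lipschitz.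

   Suppose the identity also factors through the conjugate of [Z_alpha], so that there is a bounded
   conjugate linear [A : Z_alpha -> Z_alpha] that is bounded below on the vectors [(0, e_k)]. Write
   [A (e_k, 0) = (u_k, v_k)] and [A (0, e_k) = (p_k, q_k)]. The vectors
   [e^-s sum_i eps_i (e_(k_i), f s e_(k_i))], with about [e^(2 s)] terms and [|eps_i| <= 1], are
   uniformly bounded. Averaging their images over signs gives [p_k -> 0] and [u_k -> 0]
   coordinatewise, so along a subsequence the [u_k] are almost disjointly supported. The quasilinear
   map [Omega] is explicit on disjoint sums, and the remainder [r_k = q_k - Omega p_k] satisfies
     [conj (f s) r_k - (f (t + s) - f t) u_k = O(1)],  [t = - ln |u_k|],
   in l2 for every fixed scale [s] and all large [k]. As [s] varies, [conj (f s)] rotates against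
   [f (t + s) - f t] unless [t] is comparable with [s]; eliminating [u_k] between suitable scales
   shows that [r_k] is small. Hence [A (0, e_k)] gets arbitrarily small, a contradiction. *)

Require Import Defs.
From HB Require Import structures.
From mathcomp Require Import all_boot all_order all_algebra.
From mathcomp Require Import all_classical all_reals all_analysis.
From mathcomp Require Import complex ring lra.
Set Implicit Arguments. Unset Strict Implicit. Unset Printing Implicit Defensive.
Import Order.TTheory GRing.Theory Num.Theory.
Import numFieldNormedType.Exports.
Local Open Scope classical_set_scope.
Local Open Scope ring_scope.
Local Open Scope complex_scope.

(** * Complex numbers and the function [f_alpha] *)

(** Conjugation enters through a single coefficient. For the linear operator [A = id] one has
    [u_k = r_k = e_k] and [t = 0] at the only nonzero coordinate, and the relation of the overview
    with [f s] in place of its conjugate holds exactly, since [f s - (f s - f 0) = 0]. So the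
    contradiction has to come from the phase of [f s], which turns with [s] because [alpha] is
    nonzero.

    The obstacle is that [u_k] is unknown: [t] varies from coordinate to coordinate, and when it is
    of the order of [s] nothing prevents the increment of [f] from keeping in step with
    [conj (f s)]. One pair of scales does not settle such coordinates; a second pair is placed so
    far out that no [t] is intermediate for both.

    Averaging over signs yields only one good index per block. As it applies along every
    subsequence, all but finitely many indices are good, so the estimates at several scales hold for
    a common [k]. *)

Section ComplexModulus.
Variable R : realType.
Local Notation C := R[i].
Implicit Types (x y z : C).

Lemma cabsE z : (cabs z)%:C = `|z|.
Proof. by rewrite normc_def. Qed.

Lemma cabs_ge0 z : 0 <= cabs z. Proof. exact: sqrtr_ge0. Qed.

Lemma cabs0 : cabs (0 : C) = 0.
Proof. by apply: complexI; rewrite cabsE normr0. Qed.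

Lemma cabs1 : cabs (1 : C) = 1.
Proof. by apply: complexI; rewrite cabsE normr1. Qed.

Lemma cabsM x y : cabs (x * y) = cabs x * cabs y.
Proof. by apply: complexI; rewrite rmorphM/= !cabsE normrM. Qed.

Lemma cabsN x : cabs (- x) = cabs x.
Proof. by apply: complexI; rewrite !cabsE normrN. Qed.

Lemma cabsB x y : cabs (x - y) = cabs (y - x).
Proof. by rewrite -cabsN opprB. Qed.

Lemma cabsD x y : cabs (x + y) <= cabs x + cabs y.
Proof. by rewrite -lecR rmorphD/= !cabsE ler_normD. Qed.

Lemma cabsR (t : R) : cabs t%:C = `|t|.
Proof. by rewrite /cabs /= expr0n/= addr0 sqrtr_sqr. Qed.

Lemma cabsJ x : cabs x^* = cabs x.
Proof. by rewrite /cabs; case: x => a b /=; rewrite sqrrN. Qed.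

Lemma conjcM (x y : C) : conjc (x * y) = conjc x * conjc y.
Proof. exact: rmorphM. Qed.

Lemma cabs_eq0 x : (cabs x == 0) = (x == 0).
Proof.
apply/eqP/eqP => [h|->]; last exact: cabs0.
by apply/normr0_eq0; rewrite -cabsE h.
Qed.

Lemma cabs_gt0 x : (0 < cabs x) = (x != 0).
Proof. by rewrite lt_neqAle cabs_ge0 andbT eq_sym cabs_eq0. Qed.

Lemma cabsV x : cabs x^-1 = (cabs x)^-1.
Proof.
have [->|x0] := eqVneq x 0; first by rewrite invr0 cabs0 invr0.
have : cabs x * cabs x^-1 = 1 by rewrite -cabsM divff// cabs1.
move=> e; apply: (mulfI (x := cabs x)); first by rewrite cabs_eq0.
by rewrite e divff// cabs_eq0.
Qed.

Lemma cabs_sum (J : Type) (r : seq J) (P : pred J) (F : J -> C) :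
  cabs (\sum_(i <- r | P i) F i) <= \sum_(i <- r | P i) cabs (F i).
Proof.
elim/big_rec2: _ => [|i a b _ h]; first by rewrite cabs0.
by rewrite (le_trans (cabsD _ _))// lerD2l.
Qed.

Lemma cabs_sqr z : cabs z ^+ 2 = complex.Re z ^+ 2 + complex.Im z ^+ 2.
Proof. by rewrite sqr_sqrtr// addr_ge0// sqr_ge0. Qed.

Lemma Re_le_cabs z : `|complex.Re z| <= cabs z.
Proof.
by rewrite -(@ler_pXn2r _ 2)// ?nnegrE ?cabs_ge0// cabs_sqr real_normK ?num_real// lerDl sqr_ge0.
Qed.

Lemma Im_le_cabs z : `|complex.Im z| <= cabs z.
Proof.
by rewrite -(@ler_pXn2r _ 2)// ?nnegrE ?cabs_ge0// cabs_sqr real_normK ?num_real// lerDr sqr_ge0.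
Qed.

Lemma cabs_distD x y z : cabs (x - z) <= cabs (x - y) + cabs (y - z).
Proof. by rewrite -[x - z](subrKA y) cabsD. Qed.

Lemma cabs_parallelogram x y :
  cabs (x + y) ^+ 2 + cabs (x - y) ^+ 2 = 2 * cabs x ^+ 2 + 2 * cabs y ^+ 2.
Proof. by rewrite !cabs_sqr; case: x => a b; case: y => c d /=; ring. Qed.

End ComplexModulus.

Lemma ler_sqr_norm (R : realDomainType) (a b : R) : `|a| <= b -> a ^+ 2 <= b ^+ 2.
Proof.
move=> ab; rewrite -(real_normK (num_real a)) ler_pXn2r// ?nnegrE//.
exact: le_trans ab.
Qed.

Section Unimodular.
Variable R : realType.
Local Notation C := R[i].

Definition cis (t : R) : C := cos t +i* sin t.

Lemma cabs_cis t : cabs (cis t) = 1.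
Proof. by rewrite /cabs /= cos2Dsin2 sqrtr1. Qed.

Lemma cisD s t : cis (s + t) = cis s * cis t.
Proof.
rewrite /cis cosD sinD; apply/eqP; rewrite eq_complex /=.
by apply/andP; split; apply/eqP; ring.
Qed.

Lemma cis0 : cis 0 = 1.
Proof. by rewrite /cis cos0 sin0. Qed.

Lemma sin_cos_bounds (t : R) : 0 <= t -> `|sin t - t| <= t ^+ 2 /\ `|sin t| <= t /\ `|cos t - 1| <= t.
Proof.
move=> t0.
have drs (x : R) : is_derive x 1 (@sin R) (cos x) by exact: is_derive_sin.
have drc (x : R) : is_derive x 1 (@cos R) (- sin x) by exact: is_derive_cos.
have hs (x : R) : 0 <= x -> `|sin x| <= x.
  move=> x0; have [|c _] := @MVT_segment R sin cos 0 x x0 (fun y _ => drs y).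
    by apply: derivable_within_continuous => y _; exact: derivable_sin.
  by rewrite sin0 !subr0 => ->; rewrite normrM (ger0_norm x0) ler_piMl// cos_max.
have hc (x : R) : 0 <= x -> `|cos x - 1| <= x.
  move=> x0; have [|c _] := @MVT_segment R cos (fun x => - sin x) 0 x x0 (fun y _ => drc y).
    by apply: derivable_within_continuous => y _; exact: derivable_cos.
  by rewrite cos0 !subr0 => ->; rewrite normrM normrN (ger0_norm x0) ler_piMl// sin_max.
split; last by split; [exact: hs|exact: hc].
have dr (x : R) : is_derive x 1 (fun x : R => sin x - x) (cos x - 1).
  exact: is_deriveB.
have [|c cI] := @MVT_segment R _ _ 0 t t0 (fun y _ => dr y).
  by apply: derivable_within_continuous => y _; apply: ex_derive.
rewrite sin0 !subr0 => ->.
have [c0 ct] : 0 <= c /\ c <= t by move: cI; rewrite in_itv /= => /andP[].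
by rewrite normrM (ger0_norm t0) expr2 ler_wpM2r// (le_trans (hc _ c0)).
Qed.

Lemma cis_lip s t : cabs (cis s - cis t) <= `|s - t|.
Proof.
wlog ts : s t / t <= s.
  move=> W; case/orP: (le_total s t) => h; last exact: W.
  by rewrite cabsB distrC W.
rewrite ger0_norm ?subr_ge0//.
rewrite -(@ler_pXn2r _ 2)// ?nnegrE ?cabs_ge0 ?subr_ge0// cabs_sqr /=.
have -> : (cos s - cos t) ^+ 2 + (sin s - sin t) ^+ 2 = 2 - 2 * cos (s - t).
  rewrite cosB; have := cos2Dsin2 s; have := cos2Dsin2 t; nra.
set d := s - t; have d0 : 0 <= d / 2 by rewrite divr_ge0// subr_ge0.
have -> : cos d = 1 - 2 * sin (d / 2) ^+ 2.
  rewrite {1}(_ : d = (d / 2) *+ 2); last by rewrite -mulr_natr -mulrA mulVf ?mulr1// pnatr_eq0.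
  by rewrite cos_mulr2n; have := cos2Dsin2 (d / 2); rewrite mulr2n; lra.
have [_ [h _]] := sin_cos_bounds d0.
have : sin (d / 2) ^+ 2 <= (d / 2) ^+ 2.
  exact: ler_sqr_norm.
by rewrite expr_div_n; lra.
Qed.

Lemma cis_taylor t : cabs (cis t - 1 - 0 +i* t) <= 2 * t ^+ 2.
Proof.
have H (x : R) : 0 <= x -> cabs (cis x - 1 - 0 +i* x) <= 2 * x ^+ 2.
  move=> x0; have [hsx [_ _]] := sin_cos_bounds x0.
  have x20 : 0 <= x / 2 by rewrite divr_ge0.
  have hc : `|cos x - 1| <= x ^+ 2.
    have -> : cos x - 1 = - (2 * sin (x / 2) ^+ 2).
      rewrite {1}(_ : x = (x / 2) *+ 2); last by rewrite -mulr_natr -mulrA mulVf ?mulr1// pnatr_eq0.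
      by rewrite cos_mulr2n; have := cos2Dsin2 (x / 2); rewrite mulr2n; lra.
    rewrite normrN ger0_norm; last by rewrite pmulr_rge0 ?sqr_ge0.
    have [_ [h _]] := sin_cos_bounds x20.
    have : sin (x / 2) ^+ 2 <= (x / 2) ^+ 2.
      exact: ler_sqr_norm.
    by rewrite expr_div_n; have := sqr_ge0 x; lra.
  rewrite [X in cabs X](_ : _ = (cos x - 1)%:C + 'i * (sin x - x)%:C); last first.
    by apply/eqP; rewrite eq_complex /=; apply/andP; split; apply/eqP; ring.
  rewrite (le_trans (cabsD _ _))// cabsM !cabsR.
  have -> : cabs ('i : C) = 1 by rewrite /cabs /= expr0n expr1n add0r sqrtr1.
  by lra.
case: (leP 0 t) => [|t0]; first exact: H.
have /H : 0 <= - t by lra.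
rewrite sqrrN; congr (_ <= _); rewrite -cabsJ; congr cabs.
by apply/eqP; rewrite eq_complex /= cosN sinN; apply/andP; split; apply/eqP; ring.
Qed.

End Unimodular.

Section Scalar.
Variables (R : realType) (alpha : R).
Local Notation C := R[i].
Local Notation f := (@f_alpha R alpha).
Implicit Types (s t : R) (z w : C).

Definition lipc : R := 1 + `|alpha|.
Local Notation L := lipc.

Lemma lipc_ge1 : 1 <= L. Proof. by rewrite lerDl. Qed.
Lemma lipc_gt0 : 0 < L. Proof. by rewrite (lt_le_trans _ lipc_ge1). Qed.
Hint Resolve lipc_gt0 : core.
Lemma lipc_ge0 : 0 <= L. Proof. exact: ltW. Qed.
Hint Resolve lipc_ge0 : core.

Definition phase t : C := cis (alpha * ln t).

Lemma f_alphaE t : f t = t%:C * phase t. Proof. by []. Qed.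

Lemma cabs_phase t : cabs (phase t) = 1. Proof. exact: cabs_cis. Qed.

Lemma cabs_f t : cabs (f t) = `|t|.
Proof. by rewrite f_alphaE cabsM cabs_phase cabsR mulr1. Qed.

Lemma f_alpha0 : f 0 = 0. Proof. by rewrite f_alphaE mul0r. Qed.

(** [ln] is 0 on nonpositive numbers, so [f] continues to the negative axis as the identity. It
    stays Lipschitz there, and [twist] takes these values at coordinates of modulus above 1. *)
Lemma f_alpha_le0 t : t <= 0 -> f t = t%:C.
Proof. by move=> t0; rewrite f_alphaE /phase ln0// mulr0 cis0 mulr1. Qed.

Lemma ln_le_div (a b : R) : 0 < a -> 0 < b -> ln a - ln b <= a / b - 1.
Proof.
move=> a0 b0; rewrite -ln_div ?posrE//.
have := @le_ln1Dx R (a / b - 1); rewrite [1 + _]addrC subrK; apply.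
by rewrite ltrBDl addrN divr_gt0.
Qed.

(* The phase factor varies by at most [|alpha| ln (s / t)], and [t ln (s / t) <= s - t]. *)
Lemma f_alpha_lip s t : cabs (f s - f t) <= L * `|s - t|.
Proof.
wlog ts : s t / t <= s.
  move=> W; case/orP: (le_total s t) => h; last exact: W.
  by rewrite cabsB distrC W.
have st0 : 0 <= s - t by rewrite subr_ge0.
rewrite (ger0_norm st0).
have LE : s - t <= L * (s - t) by rewrite ler_peMl// lipc_ge1.
case: (leP s 0) => [s0|s0].
  by rewrite !f_alpha_le0 ?(le_trans ts)// -rmorphB cabsR ger0_norm.
case: (leP t 0) => [t0|t0].
  rewrite (f_alpha_le0 t0) (le_trans _ LE)// (le_trans (cabsD _ _))//.
  by rewrite cabs_f cabsN cabsR gtr0_norm// ler0_norm.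
have -> : f s - f t = (s - t)%:C * phase s + t%:C * (phase s - phase t).
  by rewrite !f_alphaE rmorphB; ring.
rewrite (le_trans (cabsD _ _))// !cabsM cabs_phase !cabsR (ger0_norm st0) mulr1 (gtr0_norm t0).
rewrite mulrDl mul1r lerD2l.
have h : cabs (phase s - phase t) <= `|alpha| * (s / t - 1).
  rewrite (le_trans (cis_lip _ _))// -mulrBr normrM ler_wpM2l//.
  by rewrite ger0_norm ?ln_le_div// subr_ge0 ler_ln.
rewrite (le_trans (ler_wpM2l (ltW t0) h))//.
rewrite (_ : t * _ = `|alpha| * (s - t))//.
by field; rewrite gt_eqF.
Qed.

(** Multiplied by [b], the right side becomes [a ^+ 2 + b ^+ 2]; this is what makes logarithmic
    discrepancies between two l2 sequences summable. Both signs of the logarithm follow from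
    [ln x <= x - 1]. *)
Lemma mul_dist_ln_le (a b : R) : 0 < a -> 0 < b -> a * `|ln a - ln b| <= b + a ^+ 2 / b.
Proof.
move=> a0 b0; case: (leP (ln b) (ln a)) => h.
  rewrite ger0_norm ?subr_ge0//.
  rewrite (le_trans (ler_wpM2l (ltW a0) (ln_le_div a0 b0)))//.
  rewrite mulrBr mulr1 mulrA -expr2; lra.
rewrite ltr0_norm ?subr_lt0// opprB.
rewrite (le_trans (ler_wpM2l (ltW a0) (ln_le_div b0 a0)))//.
rewrite (_ : a * _ = b - a); last by field; rewrite gt_eqF.
have : 0 <= a ^+ 2 / b by rewrite divr_ge0 ?sqr_ge0// ltW.
lra.
Qed.

(* [Omega] without the normalisation by the l2 norm: the two differ boundedly on bounded subsets of
   l2, and [twist] acts coordinatewise. *)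
Definition twist z : C := z * f (- ln (cabs z)).
Local Notation h := twist.

Lemma twist0 : h 0 = 0. Proof. by rewrite /h mul0r. Qed.

Lemma twist_mul z w :
  cabs (h (z * w) - z * h w) <= L * (cabs z * `|ln (cabs z)|) * cabs w.
Proof.
have [->|z0] := eqVneq z 0; first by rewrite !mul0r twist0 subrr cabs0 !mul0r mulr0 mul0r.
have [->|w0] := eqVneq w 0; first by rewrite mulr0 twist0 mulr0 subrr cabs0 mulr0.
rewrite /h mulrA -mulrBr cabsM cabsM cabsM lnM ?posrE ?cabs_gt0//.
rewrite (le_trans (ler_wpM2l _ (f_alpha_lip _ _)))//; first by rewrite mulr_ge0 ?cabs_ge0.
rewrite opprD opprK subrK normrN le_eqVlt; apply/orP; left; apply/eqP; ring.
Qed.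

(* All three terms are compared with the linear map [x |-> x * f (- ln (cabs z))], where [z] is the
   larger summand. *)
Lemma twistD z w : cabs (h (z + w) - h z - h w) <= 7 * L * (cabs z + cabs w).
Proof.
wlog wz : z w / cabs w <= cabs z.
  move=> W; case/orP: (le_total (cabs w) (cabs z)) => ?; first exact: W.
  by rewrite [z + w]addrC addrAC [cabs z + _]addrC W.
have [w0|w0] := eqVneq w 0.
  by rewrite w0 addr0 twist0 subrr subr0 cabs0 pmulr_rge0 ?addr_ge0 ?cabs_ge0// mulr_gt0.
have w0' : 0 < cabs w by rewrite cabs_gt0.
have z0 : 0 < cabs z by exact: lt_le_trans wz.
set l := - ln (cabs z).
have -> : h (z + w) - h z - h w =
    (z + w) * (f (- ln (cabs (z + w))) - f l) + w * (f l - f (- ln (cabs w))).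
  by rewrite /h -/l; ring.
have H1 : cabs ((z + w) * (f (- ln (cabs (z + w))) - f l)) <= L * (5 * cabs z).
  have [->|s0] := eqVneq (z + w) 0; first by rewrite mul0r cabs0 !mulr_ge0 ?cabs_ge0.
  have s0' : 0 < cabs (z + w) by rewrite cabs_gt0.
  rewrite cabsM (le_trans (ler_wpM2l (cabs_ge0 _) (f_alpha_lip _ _)))//.
  rewrite mulrCA ler_wpM2l// /l opprK [- _ + _]addrC distrC.
  rewrite (le_trans (mul_dist_ln_le s0' z0))//.
  have sz : cabs (z + w) <= 2 * cabs z by rewrite (le_trans (cabsD _ _))//; lra.
  have : cabs (z + w) ^+ 2 / cabs z <= 4 * cabs z.
    by rewrite ler_pdivrMr//; have := cabs_ge0 (z + w); nra.
  by lra.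
have H2 : cabs (w * (f l - f (- ln (cabs w)))) <= L * (2 * cabs z).
  rewrite cabsM (le_trans (ler_wpM2l (cabs_ge0 _) (f_alpha_lip _ _)))//.
  rewrite mulrCA ler_wpM2l// /l opprK [- _ + _]addrC.
  rewrite (le_trans (mul_dist_ln_le w0' z0))//.
  have : cabs w ^+ 2 / cabs z <= cabs z by rewrite ler_pdivrMr//; nra.
  by lra.
rewrite (le_trans (cabsD _ _))// (le_trans (lerD H1 H2))//.
rewrite -mulrDr -mulrDl -mulrA [leRHS]mulrCA ler_wpM2l//.
have := cabs_ge0 w; lra.
Qed.

(** The crude factor [N] is harmless: in the end the terms are made small after [N] is fixed. *)
Lemma twist_sum N (a : nat -> C) :
  cabs (h (\sum_(i < N) a i) - \sum_(i < N) h (a i)) <= 7 * L * N%:R * \sum_(i < N) cabs (a i).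
Proof.
elim: N => [|N IH]; first by rewrite !big_ord0 twist0 subrr cabs0 mulr0.
rewrite !big_ord_recr /=.
set S := \sum_(i < N) a i in IH *; set T := \sum_(i < N) h (a i) in IH *.
set A := \sum_(i < N) cabs (a i) in IH *.
have SA : cabs S <= A by exact: cabs_sum.
rewrite (_ : h (S + a N) - (T + h (a N)) = (h (S + a N) - h S - h (a N)) + (h S - T)); last by ring.
rewrite (le_trans (cabsD _ _))// (le_trans (lerD (twistD _ _) IH))//.
have c0 := cabs_ge0 (a N); have K0 : 0 <= 7 * L by rewrite mulr_ge0.
rewrite -!(mulrA (7 * L)) -mulrDr ler_wpM2l//.
have A0 : 0 <= A by exact: le_trans (cabs_ge0 _) SA.
rewrite -[N.+1%:R]natr1; have : 0 <= N%:R * cabs (a N) by rewrite mulr_ge0.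
by lra.
Qed.

End Scalar.

(** * Increments of [f_alpha] and the choice of two scales *)

Section TwoScale.
Variables (R : realType) (alpha : R).
Local Notation C := R[i].
Local Notation f := (@f_alpha R alpha).
Local Notation phase := (phase alpha).
Local Notation L := (lipc alpha).
Implicit Types (s t : R).

(** Multiplying [x] by [expR (- s)] shifts [t = - ln (cabs x)] by [s]; this is the multiplier that
    results in [twist_shift]. *)
Definition incr s t : C := f (t + s) - f t.

Lemma incrE s t : incr s t = f (t + s) - f t. Proof. by []. Qed.

Lemma incr_le s t : 0 <= s -> cabs (incr s t) <= L * s.
Proof.
move=> s0; rewrite (le_trans (f_alpha_lip _ _ _))// [t + s]addrC addrK ger0_norm//.
Qed.

Lemma incr_small s t : cabs (incr s t - f s) <= (L + 1) * `|t|.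
Proof.
rewrite /incr (_ : _ - f s = (f (t + s) - f s) - f t); last by ring.
rewrite (le_trans (cabsD _ _))// cabsN cabs_f mulrDl mul1r lerD2r.
by rewrite (le_trans (f_alpha_lip _ _ _))// addrK.
Qed.

(** First order expansion of [f] at [t], where its derivative is [(1 +i* alpha) * phase t]; the
    second derivative decays like [1 / t]. *)
Lemma incr_large s t : 0 < s -> s <= t ->
  cabs (incr s t - s%:C * (1 +i* alpha) * phase t) <=
  (`|alpha| + 4 * alpha ^+ 2) * (s ^+ 2 / t).
Proof.
move=> s0 st; have t0 : 0 < t by exact: lt_le_trans st.
have ts0 : 0 < t + s by exact: addr_gt0.
pose l := ln (t + s) - ln t; pose th := alpha * l.
have lu : l <= s / t.
  have := ln_le_div ts0 t0; rewrite -/l => h; rewrite (le_trans h)//.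
  by rewrite le_eqVlt; apply/orP; left; apply/eqP; field; rewrite gt_eqF.
have ll : s <= (t + s) * l.
  have := ln_le_div t0 ts0; rewrite -opprB -/l.
  have -> : t / (t + s) - 1 = - (s / (t + s)) by field; rewrite gt_eqF.
  by rewrite lerN2 ler_pdivrMr// mulrC.
have l0 : 0 <= l by rewrite -(pmulr_rge0 _ ts0) (le_trans (ltW s0)).
have lu2 : (t + s) * l <= s + s ^+ 2 / t.
  rewrite (le_trans (ler_wpM2l (ltW ts0) lu))//.
  by rewrite le_eqVlt; apply/orP; left; apply/eqP; field; rewrite gt_eqF.
have pE : phase (t + s) = phase t * cis th.
  by rewrite /phase -cisD /th /l; congr cis; ring.
have -> : incr s t - s%:C * (1 +i* alpha) * phase t =
    phase t * ((t + s)%:C * (cis th - 1 - 0 +i* th) + (0 +i* ((t + s) * th - alpha * s))).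
  rewrite /incr !f_alphaE pE.
  have -> : 1 +i* alpha = 1 + 'i * alpha%:C by apply/eqP; rewrite eq_complex /=; apply/andP; split; apply/eqP; ring.
  have -> : (0 +i* th : C) = 'i * th%:C by apply/eqP; rewrite eq_complex /=; apply/andP; split; apply/eqP; ring.
  have -> : (0 +i* ((t + s) * th - alpha * s) : C) = 'i * ((t + s)%:C * th%:C - alpha%:C * s%:C).
    by apply/eqP; rewrite eq_complex /=; apply/andP; split; apply/eqP; ring.
  by rewrite rmorphD /=; ring.
rewrite cabsM cabs_phase mul1r (le_trans (cabsD _ _))// cabsM cabsR (gtr0_norm ts0).
have H1 : (t + s) * cabs (cis th - 1 - 0 +i* th) <= 4 * alpha ^+ 2 * (s ^+ 2 / t).
  rewrite (le_trans (ler_wpM2l (ltW ts0) (cis_taylor _)))//.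
  have l2 : l ^+ 2 <= (s / t) ^+ 2 by rewrite ler_pXn2r// nnegrE (le_trans l0 lu).
  have -> : (t + s) * (2 * th ^+ 2) = 2 * alpha ^+ 2 * ((t + s) * l ^+ 2) by rewrite /th; ring.
  have -> : 4 * alpha ^+ 2 * (s ^+ 2 / t) = 2 * alpha ^+ 2 * (2 * t * (s / t) ^+ 2).
    by field; rewrite gt_eqF.
  apply: ler_wpM2l; first by rewrite mulr_ge0// sqr_ge0.
  apply: ler_pM => //; [exact: ltW|exact: sqr_ge0|lra].
have H2 : cabs (0 +i* ((t + s) * th - alpha * s)) <= `|alpha| * (s ^+ 2 / t).
  have -> : (t + s) * th - alpha * s = alpha * ((t + s) * l - s) by rewrite /th; ring.
  rewrite /cabs /= expr0n add0r sqrtr_sqr normrM ler_wpM2l// ger0_norm; lra.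
by rewrite [leRHS]mulrDl; lra.
Qed.

Hypothesis alpha0 : alpha != 0.

(* The ratio of the two scales is chosen so that it turns the phase by a right angle. *)
Definition scale_ratio : R := expR (pi / 2 / `|alpha|).

Lemma scale_ratio_gt1 : 1 < scale_ratio.
Proof. by rewrite expR_gt1 !divr_gt0 ?pi_gt0 ?normr_gt0. Qed.

Lemma scale_ratio_gt0 : 0 < scale_ratio. Proof. exact: expR_gt0. Qed.

Lemma phase_ratio s : 0 < s -> exists e : R, [/\ e ^+ 2 = 1 &
  phase (scale_ratio * s) = phase s * (0 +i* e)].
Proof.
move=> s0; exists (sin (alpha * (pi / 2 / `|alpha|))).
have cs : cos (alpha * (pi / 2 / `|alpha|)) = 0.
  have -> : alpha * (pi / 2 / `|alpha|) = Num.sg alpha * (pi / 2).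
    by rewrite {1}(numEsg alpha); field; rewrite normr_eq0.
  by rewrite cos_sg// cos_pihalf.
split; first by rewrite sin2cos2 cs expr0n subr0.
rewrite /phase lnM ?posrE ?scale_ratio_gt0// /scale_ratio expRK mulrDr addrC cisD.
by rewrite {2}/cis cs.
Qed.

(* [|f|] is the identity on positive numbers and the increment of [f] over [s] behaves like [f s] near
   [0] and like [s (1 + i alpha) t^(i alpha)] near infinity; in both regimes its phase does not
   rotate with [s] in the way the conjugate of [f s] does. *)
Lemma two_scale : exists2 eta : R, 0 < eta <= 1 & forall s t, 0 < s ->
  `|t| <= eta * s \/ scale_ratio * s / eta <= t ->
  s * (scale_ratio * s) <=
    2 * cabs (incr (scale_ratio * s) t * (conjc (f s)) - incr s t * (conjc (f (scale_ratio * s)))).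
Proof.
pose K := `|alpha| + 4 * alpha ^+ 2.
have K0 : 0 <= K by rewrite addr_ge0// mulr_ge0// sqr_ge0.
have L1 : 1 <= L := lipc_ge1 alpha.
(* With [eta = D^-1] each increment is within a quarter of its scale of its approximation, so the
   errors use up at most half of [s * s'], a lower bound for the main term. *)
pose D := 4 * (L + 1 + K); have D1 : 1 <= D by rewrite /D; lra.
have D0 : 0 < D by lra.
exists D^-1; first by rewrite invr_gt0 D0 invf_le1.
move=> s t s0; have [s' s'E] : exists s', s' = scale_ratio * s by exists (scale_ratio * s).
rewrite -s'E => Hst.
have s'0 : 0 < s' by rewrite s'E mulr_gt0// scale_ratio_gt0.
have ss' : s <= s' by rewrite s'E ler_peMl// ltW// scale_ratio_gt1.
have [e [e2 pe]] := phase_ratio s0; rewrite -s'E in pe.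
have pp : phase s * (conjc (phase s)) = 1.
  by rewrite -sqr_normc -cabsE cabs_phase expr1n.
have peJ : conjc (phase s') = conjc (phase s) * (0 -i* e).
  by rewrite pe; case: (phase s) => a b; apply/eqP; rewrite eq_complex /=; apply/andP; split; apply/eqP; ring.
have fJ u : (conjc (f u)) = u%:C * (conjc (phase u)).
  rewrite f_alphaE; case: (phase u) => a b; apply/eqP; rewrite eq_complex /=.
  by apply/andP; split; apply/eqP; ring.
have cfJ (u : R) : 0 < u -> cabs (conjc (f u)) = u by move=> u0; rewrite cabsJ cabs_f gtr0_norm.
have sss : 0 <= s * s' by rewrite mulr_ge0 ?ltW.
have fin (m e1 e2' : C) : s * s' <= cabs m ->
    cabs (e1 * (conjc (f s))) + cabs (e2' * (conjc (f s'))) <= s * s' / 2 ->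
    s * s' <= 2 * cabs (m + (e1 * (conjc (f s)) - e2' * (conjc (f s')))).
  move=> hm he; set z := e1 * _ - _.
  have hz : cabs z <= s * s' / 2 by rewrite (le_trans (cabsD _ _))// cabsN.
  have : cabs m <= cabs (m + z) + cabs z.
    by rewrite -{1}[m](addrK z) (le_trans (cabsD _ _))// cabsN.
  lra.
case: Hst => [ts|ts].
  pose e1 := incr s' t - f s'; pose e2' := incr s t - f s.
  have -> : incr s' t * (conjc (f s)) - incr s t * (conjc (f s')) =
     (f s' * (conjc (f s)) - f s * (conjc (f s'))) + (e1 * (conjc (f s)) - e2' * (conjc (f s'))).
    by rewrite /e1 /e2'; ring.
  have ht : (L + 1) * `|t| <= s / 4.
    rewrite (le_trans (ler_wpM2l _ ts))//; first by lra.
    rewrite mulrA [leRHS]mulrC ler_wpM2r ?(ltW s0)// ler_pdivrMr// /D; lra.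
  apply: fin.
    (* The right angle between [phase s] and [phase s'] makes the two products opposite, so they
       reinforce each other. *)
    have -> : f s' * (conjc (f s)) - f s * (conjc (f s')) =
       (s * s')%:C * (phase s * (conjc (phase s))) * (0 +i* (2 * e)).
      have -> : (0 +i* (2 * e) : C) = (0 +i* e) - (0 -i* e).
        by apply/eqP; rewrite eq_complex /=; apply/andP; split; apply/eqP; ring.
      by rewrite !fJ !f_alphaE peJ pe rmorphM/=; ring.
    rewrite pp mulr1 cabsM cabsR (ger0_norm sss) ler_peMr//.
    rewrite /cabs /= expr0n /= add0r exprMn e2 mulr1 sqrtr_sqr ger0_norm// ?ler1n//.
  rewrite !cabsM !cfJ//.
  have h1 : cabs e1 * s <= s / 4 * s'.
    apply: ler_pM => //; [exact: cabs_ge0|exact: ltW|exact: le_trans (incr_small _ _) ht].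
  have h2 : cabs e2' * s' <= s / 4 * s'.
    by apply: ler_wpM2r; [exact: ltW|exact: le_trans (incr_small _ _) ht].
  lra.
have t0 : 0 < t.
  by rewrite (lt_le_trans _ ts)// divr_gt0// invr_gt0.
have s't : s' * D <= t by move: ts; rewrite invrK.
have s't' : s' <= t by rewrite (le_trans _ s't)// ler_peMr// ltW.
pose m := (1 +i* alpha) * phase t.
pose e1 := incr s' t - s'%:C * m; pose e2' := incr s t - s%:C * m.
have -> : incr s' t * (conjc (f s)) - incr s t * (conjc (f s')) =
   (s'%:C * m * (conjc (f s)) - s%:C * m * (conjc (f s'))) + (e1 * (conjc (f s)) - e2' * (conjc (f s'))).
  by rewrite /e1 /e2'; ring.
have He u : 0 < u -> u <= s' -> cabs (incr u t - u%:C * m) * D <= K * u.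
  move=> u0 us'; have := incr_large u0 (le_trans us' s't').
  rewrite /m mulrA -/K => h; rewrite (le_trans (ler_wpM2r (ltW D0) h))//.
  rewrite -mulrA; apply: ler_wpM2l => //.
  have -> : u ^+ 2 / t * D = u * (u * D / t) by field; rewrite gt_eqF.
  apply: ler_piMr; first exact: ltW.
  rewrite ler_pdivrMr// mul1r (le_trans _ s't)// ler_wpM2r//; exact: ltW.
apply: fin.
  (* With equal phases the two products would coincide; the quarter turn leaves the factor
     [1 +i* e]. *)
  have -> : s'%:C * m * (conjc (f s)) - s%:C * m * (conjc (f s')) =
     (s * s')%:C * (phase t * (conjc (phase s)) * ((1 +i* alpha) * (1 +i* e))).
    have -> : (1 +i* e : C) = 1 - (0 -i* e).
      by apply/eqP; rewrite eq_complex /=; apply/andP; split; apply/eqP; ring.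
    by rewrite !fJ peJ rmorphM/= /m; ring.
  rewrite cabsM cabsR (ger0_norm sss) ler_peMr// !cabsM cabsJ !cabs_phase !mul1r.
  have h1 (b : R) : 1 <= cabs (1 +i* b).
    by have := Re_le_cabs (1 +i* b); rewrite /= normr1.
  by rewrite mulr_ege1.
rewrite !cabsM !cfJ//.
have KD : K <= D / 4 by rewrite /D; lra.
have half u : 0 < u -> u <= s' -> cabs (incr u t - u%:C * m) <= u / 4.
  move=> u0 us'; rewrite -(ler_pM2r D0) (le_trans (He _ u0 us'))//.
  by rewrite mulrC mulrAC -mulrA ler_wpM2l// ltW.
have h1 : cabs e1 * s <= s' / 4 * s by rewrite ler_wpM2r ?half// ltW.
have h2 : cabs e2' * s' <= s / 4 * s' by rewrite ler_wpM2r ?half// ltW.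
lra.
Qed.

End TwoScale.

(** * The twisted sum as a Banach space *)

Section DualNorm.
Variables (R : realType) (alpha : R).
Local Notation C := R[i].
Local Notation h := (twist alpha).
Implicit Types (v w : nat -> C) (z : seqpair R) (M : R).

Definition sqs (n : nat) (x : nat -> C) : R := \sum_(k < n) cabs (x k) ^+ 2.

(* The functional on the twisted sum given by the pair [(v - h w, w)] of the dual twisted sum; the
   pairing is bilinear, hence the sign in front of [h w]. *)
Definition test n v w z : C :=
  \sum_(k < n) (z.1 k * (v k - h (w k)) + z.2 k * w k).

Lemma testE n v w z :
  test n v w z = \sum_(k < n) (z.1 k * (v k - h (w k)) + z.2 k * w k).
Proof. by []. Qed.

Definition test_le z M : Prop := forall n v w,
  sqs n v <= 1 -> sqs n w <= 1 -> cabs (test n v w z) <= M.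

Lemma sqs0 n : sqs n (fun=> 0) = 0.
Proof. by rewrite /sqs big1// => i _; rewrite cabs0 expr0n. Qed.

Lemma testD n v w z z' : test n v w (z + z') = test n v w z + test n v w z'.
Proof. by rewrite /test -big_split; apply: eq_bigr => i _ /=; rewrite !mulrDl addrACA. Qed.

Lemma testZ n v w (a : C) z : test n v w (a *: z) = a * test n v w z.
Proof.
rewrite /test mulr_sumr; apply: eq_bigr => i _.
transitivity (a * z.1 i * (v i - h (w i)) + a * z.2 i * w i); first by [].
by rewrite [RHS]mulrDr !mulrA.
Qed.

Lemma testB n v w z z' : test n v w (z - z') = test n v w z - test n v w z'.
Proof. by rewrite -scaleN1r testD testZ mulN1r. Qed.

Lemma test_leD z z' M M' : test_le z M -> test_le z' M' -> test_le (z + z') (M + M').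
Proof.
move=> H H' n v w v1 w1; rewrite testD (le_trans (cabsD _ _))// lerD//.
  exact: H.
exact: H'.
Qed.

Lemma test_leZ (a : C) z M : test_le z M -> test_le (a *: z) (cabs a * M).
Proof.
move=> H n v w v1 w1; rewrite testZ cabsM ler_wpM2l ?cabs_ge0//.
exact: H.
Qed.

Lemma test_le0 : test_le 0 0.
Proof.
move=> n v w _ _; rewrite /test big1 ?cabs0// => i _.
by rewrite /= !mul0r addr0.
Qed.

Lemma test_le_coord1 z M k : test_le z M -> cabs (z.1 k) <= M.
Proof.
move=> /(_ k.+1 (fun j => if j == k then 1 else 0) (fun=> 0)).
rewrite sqs0 /sqs /test !big_ord_recr /= !eqxx cabs1 expr1n twist0 subr0 mulr1 mulr0 addr0.
rewrite !big1 ?add0r; first by apply.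
  by move=> i _; rewrite !ltn_eqF// subr0 !mulr0 addr0.
by move=> i _; rewrite !ltn_eqF// cabs0 expr0n.
Qed.

Lemma test_le_coord2 z M k : test_le z M -> cabs (z.2 k) <= M.
Proof.
have h1 : h 1 = 0.
  by rewrite /twist cabs1 ln1 oppr0 f_alpha0 mulr0.
move=> /(_ k.+1 (fun=> 0) (fun j => if j == k then 1 else 0)).
rewrite sqs0 /sqs /test !big_ord_recr /= !eqxx cabs1 expr1n h1 subr0 mulr1 mulr0 add0r.
rewrite !big1 ?add0r; first by apply.
  by move=> i _; rewrite !ltn_eqF// twist0 subr0 !mulr0 addr0.
by move=> i _; rewrite !ltn_eqF// cabs0 expr0n.
Qed.

(** Through functionals, closure under sums is immediate; through [in_Z] it would need the
    quasilinearity of [Omega]. By [test_le_Znorm] and [test_le_in_Z] the two domains agree. *)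
Definition Zdom : {pred seqpair R} := fun z => `[< exists M, test_le z M >].

Lemma ZdomP z : reflect (exists M, test_le z M) (z \in Zdom).
Proof. exact: asboolP. Qed.

Fact Zdom_submod : submod_closed Zdom.
Proof.
split; first by apply/ZdomP; exists 0; exact: test_le0.
move=> a z z' /ZdomP [M H] /ZdomP [M' H'].
by apply/ZdomP; exists (cabs a * M + M'); apply: test_leD => //; exact: test_leZ.
Qed.

HB.instance Definition _ := GRing.isSubmodClosed.Build C (seqpair R) Zdom Zdom_submod.

Record Zspace := MkZspace { zval :> seqpair R; _ : zval \in Zdom }.

HB.instance Definition _ := [isSub for zval].
HB.instance Definition _ := [Choice of Zspace by <:].
HB.instance Definition _ := [SubChoice_isSubLmodule of Zspace by <:].

Lemma zvalD (x y : Zspace) : zval (x + y) = zval x + zval y.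
Proof. exact: (raddfD (\val : Zspace -> seqpair R)). Qed.

Lemma zvalZ (a : C) (x : Zspace) : zval (a *: x) = a *: zval x.
Proof. exact: GRing.valZ. Qed.

Lemma zvalB (x y : Zspace) : zval (x - y) = zval x - zval y.
Proof. exact: (raddfB (\val : Zspace -> seqpair R)). Qed.

Lemma zval0 : zval 0 = 0.
Proof. exact: (raddf0 (\val : Zspace -> seqpair R)). Qed.

Definition test_set z : set R :=
  [set r | exists n v w, [/\ sqs n v <= 1, sqs n w <= 1 & r = cabs (test n v w z)]]%classic.

(** A supremum of moduli of linear functionals obeys the exact triangle inequality, whereas the
    quasi-norm [Znorm] obeys it up to a constant. *)
Definition dual_norm z : R := sup (test_set z).

Lemma test_set_neq0 z : (test_set z !=set0)%classic.
Proof.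
exists (cabs (test 0 (fun=> 0) (fun=> 0) z)); exists 0%N, (fun=> 0), (fun=> 0).
by rewrite sqs0 ler01.
Qed.

Lemma dual_norm_le z M : test_le z M -> dual_norm z <= M.
Proof.
move=> H; apply: ge_sup; first exact: test_set_neq0.
by move=> _ [n [v [w [v1 w1 ->]]]]; exact: H.
Qed.

Lemma dual_normP z : z \in Zdom -> test_le z (dual_norm z).
Proof.
move=> /ZdomP[M H] n v w v1 w1; apply: ub_le_sup.
  by exists M => _ [n' [v' [w' [v1' w1' ->]]]]; exact: H.
by exists n, v, w.
Qed.

Lemma Zspace_test (x : Zspace) : test_le x (dual_norm x).
Proof. by apply: dual_normP; case: x. Qed.

Lemma dual_norm_ge0 (x : Zspace) : 0 <= dual_norm x.
Proof. exact: le_trans (cabs_ge0 _) (test_le_coord1 0 (Zspace_test x)). Qed.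

Lemma dual_normD (x y : Zspace) : (dual_norm (x + y : Zspace))%:C <= (dual_norm x)%:C + (dual_norm y)%:C.
Proof.
rewrite -rmorphD/= lecR; apply: dual_norm_le.
by apply: test_leD; exact: Zspace_test.
Qed.

Lemma dual_normZ_le (a : C) (x : Zspace) : dual_norm (a *: x : Zspace) <= cabs a * dual_norm x.
Proof. by apply: dual_norm_le; apply: test_leZ; exact: Zspace_test. Qed.

Lemma dual_normZ (a : C) (x : Zspace) : (dual_norm (a *: x : Zspace))%:C = `|a| * (dual_norm x)%:C.
Proof.
rewrite -cabsE -rmorphM; congr (_ %:C); apply/eqP; rewrite eq_le dual_normZ_le andTb.
have [->|a0] := eqVneq a 0; first by rewrite cabs0 mul0r; exact: dual_norm_ge0.
rewrite -ler_pdivlMl ?cabs_gt0// -cabsV.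
by rewrite -{1}[x](scalerK a0); exact: dual_normZ_le.
Qed.

Lemma dual_norm0_eq0 (x : Zspace) : (dual_norm x)%:C = 0 -> x = 0.
Proof.
move=> /complexI x0; have H := Zspace_test x; rewrite x0 in H.
apply: val_inj; rewrite [LHS]/= [RHS]zval0; apply/eqP; rewrite -pair_eqE; apply/andP.
split; apply/eqP/funext => k; apply/eqP; rewrite -cabs_eq0 eq_le cabs_ge0 andbT.
  exact: (test_le_coord1 k H).
exact: (test_le_coord2 k H).
Qed.

HB.instance Definition _ :=
  @Lmodule_isNormed.Build C Zspace (fun x => (dual_norm x)%:C) dual_normD dual_normZ dual_norm0_eq0.

Lemma ZnormE (x : Zspace) : `|x| = (dual_norm x)%:C.
Proof. by []. Qed.

End DualNorm.

(** * Completeness of the dual norm *)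

Section Complete.
Variables (R : realType) (alpha : R).
Local Notation C := R[i].
Local Notation Zspace := (Zspace alpha).

Section FilterLimit.
Variables (T : Type) (F : set_system T).
Context {FF : ProperFilter F}.

Definition tends (phi : T -> C) (l : C) :=
  forall e : R, 0 < e -> F [set y | cabs (l - phi y) <= e]%classic.

Lemma tends_cst l : tends (fun=> l) l.
Proof. by move=> e e0; apply: filterE => y /=; rewrite subrr cabs0 ltW. Qed.

Lemma tendsD phi psi l m : tends phi l -> tends psi m ->
  tends (fun y => phi y + psi y) (l + m).
Proof.
move=> H1 H2 e e0; have e2 : 0 < e / 2 by rewrite divr_gt0.
apply: filterS (filterI (H1 _ e2) (H2 _ e2)) => y [/= h1 h2].
by rewrite opprD addrACA (le_trans (cabsD _ _))//; lra.
Qed.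

Lemma tendsM phi l a : tends phi l -> tends (fun y => phi y * a) (l * a).
Proof.
move=> H e e0; have a0 := cabs_ge0 a.
have e1 : 0 < e / (1 + cabs a) by rewrite divr_gt0// ltr_pwDl.
apply: filterS (H _ e1) => y /= h; rewrite -mulrBl cabsM.
rewrite (le_trans (ler_wpM2r a0 h))// mulrAC ler_pdivrMr; last by rewrite ltr_pwDl.
by rewrite ler_wpM2l ?ltW//; lra.
Qed.

Lemma tends_sum n (phi : nat -> T -> C) (l : nat -> C) :
  (forall k, tends (phi k) (l k)) ->
  tends (fun y => \sum_(k < n) phi k y) (\sum_(k < n) l k).
Proof.
move=> H; elim: n => [|n IH].
  by rewrite big_ord0; under eq_fun do rewrite big_ord0; exact: tends_cst.
rewrite big_ord_recr /=; under eq_fun do rewrite big_ord_recr /=.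
exact: tendsD.
Qed.

End FilterLimit.

Variable F : set_system Zspace.
Hypotheses (FF : ProperFilter F) (Fc : cauchy F).

Lemma cauchy_center (e : R) : 0 < e ->
  exists x : Zspace, F [set y : Zspace | dual_norm alpha (y - x : Zspace) <= e]%classic.
Proof.
move=> e0; have ce : 0 < e%:C by rewrite ltcR.
have [x Fx] := (cauchyP F).1 Fc _ ce.
exists x; apply: filterS Fx => y; rewrite -ball_normE /ball_ /= distrC ZnormE ltcR.
exact: ltW.
Qed.

Lemma cauchy_real_lim (g : Zspace -> R) :
  (forall x y : Zspace, `|g y - g x| <= dual_norm alpha (y - x : Zspace)) ->
  exists l : R, forall e : R, 0 < e -> F [set y | `|l - g y| <= e]%classic.
Proof.
move=> H; have GF : ProperFilter (g @ F) by exact: fmap_proper_filter.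
have gc : cauchy (g @ F).
  apply: cauchy_exP => e e0; have e2 : 0 < e / 2 by rewrite divr_gt0.
  have [x Fx] := cauchy_center e2.
  exists (g x); suff : F (g @^-1` ball (g x) e) by [].
  apply: filterS Fx => y /= yx.
  rewrite -ball_normE /ball_ /= distrC; apply: (le_lt_trans (H x y)); apply: (le_lt_trans yx).
  by rewrite ltr_pdivrMr// ltr_pMr// ltr1n.
have gcv : cvg (g @ F) by exact: cauchy_cvg.
move: gcv => /cvg_ex[/= l gl].
exists l => e e0.
by have /cvgrPdist_le := gl; exact.
Qed.

Lemma cauchy_complex_lim (g : Zspace -> C) :
  (forall x y : Zspace, cabs (g y - g x) <= dual_norm alpha (y - x : Zspace)) ->
  exists l : C, tends F g l.
Proof.
move=> H.
have [|a Ha] := @cauchy_real_lim (fun x => complex.Re (g x)).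
  by move=> x y; rewrite -raddfB (le_trans (Re_le_cabs _)).
have [|b Hb] := @cauchy_real_lim (fun x => complex.Im (g x)).
  by move=> x y; rewrite -raddfB (le_trans (Im_le_cabs _)).
exists (a +i* b) => e e0; have e2 : 0 < e / 2 by rewrite divr_gt0.
apply: filterS (filterI (Ha _ e2) (Hb _ e2)) => y [/= h1 h2].
have -> : a +i* b - g y = (a - complex.Re (g y))%:C + 'i * (b - complex.Im (g y))%:C.
  by case: (g y) => c d; apply/eqP; rewrite eq_complex /=; apply/andP; split; apply/eqP; ring.
rewrite (le_trans (cabsD _ _))// cabsM !cabsR.
have -> : cabs ('i : C) = 1 by rewrite /cabs /= expr0n expr1n add0r sqrtr1.
by lra.
Qed.

(** Coordinates are dominated by the norm, so they converge along a Cauchy filter. A test involves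
    finitely many coordinates and passes to the limit, which preserves bounds uniform over all
    tests. *)
Lemma Zspace_cvg : cvg F.
Proof.
have /choice[a Ha] : forall k, exists l, tends F (fun y : Zspace => (zval y).1 k) l.
  move=> k.
  apply: cauchy_complex_lim => x y.
  exact: (test_le_coord1 k (Zspace_test (y - x))).
have /choice[b Hb] : forall k, exists l, tends F (fun y : Zspace => (zval y).2 k) l.
  move=> k.
  apply: cauchy_complex_lim => x y.
  exact: (test_le_coord2 k (Zspace_test (y - x))).
pose z : seqpair R := (a, b).
have Ht n v w : tends F (fun y => test alpha n v w (zval y)) (test alpha n v w z).
  apply: (@tends_sum _ F FF n
    (fun k y => (zval y).1 k * (v k - twist alpha (w k)) + (zval y).2 k * w k)
    (fun k => a k * (v k - twist alpha (w k)) + b k * w k)) => k.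
  by apply: tendsD; apply: tendsM.
have key (e : R) (x : Zspace) : F [set y : Zspace | dual_norm alpha (y - x : Zspace) <= e]%classic ->
    test_le alpha (z - zval x) e.
  move=> Fx n v w v1 w1; apply/ler_addgt0Pr => d d0.
  have [y [/= y1 y2]] := filter_ex (filterI (Ht n v w _ d0) Fx).
  have -> : test alpha n v w (z - zval x) =
      (test alpha n v w z - test alpha n v w (zval y)) + test alpha n v w (zval (y - x)).
    by rewrite testB zvalB testB; ring.
  rewrite (le_trans (cabsD _ _))// addrC lerD//.
  exact: le_trans (Zspace_test (y - x) v1 w1) y2.
have [x1 Fx1] := cauchy_center ltr01.
have zZ : z \in Zdom alpha.
  rewrite -[z](subrK (zval x1)); apply: rpredD; last by case: (x1).
  by apply/ZdomP; exists 1; exact: key.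
pose zz : Zspace := MkZspace zZ.
apply/cvg_ex; exists zz; apply/cvgrPdist_le => /= e e0.
have [er eE] : exists r : R, e = r%:C.
  by exists (complex.Re e); rewrite RRe_real// gtr0_real.
move: e0; rewrite eE ltcR => e0.
have e2 : 0 < er / 2 by rewrite divr_gt0.
have [x Fx] := cauchy_center e2.
apply: filterS (Fx) => y /= yx; rewrite ZnormE lecR.
apply: dual_norm_le; rewrite [er](splitr er).
have -> : zval (zz - y) = (z - zval x) + (- 1 : C) *: zval (y - x).
  by rewrite !zvalB scaleN1r opprB subrKA.
apply: test_leD; first exact: key.
move=> n v w v1 w1; rewrite (le_trans (test_leZ _ (Zspace_test _) v1 w1))//.
by rewrite cabsN cabs1 mul1r.
Qed.

End Complete.

HB.instance Definition _ (R : realType) (alpha : R) :=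
  Uniform_isComplete.Build (Zspace alpha) (@Zspace_cvg R alpha).

(** * Comparison of the quasi-norm with the dual norm *)

Section L2.
Variable R : realType.
Local Notation C := R[i].
Implicit Types (a b : nat -> R) (x y : nat -> C) (M : R).

Lemma cauchy_schwarz_le n a b A B : 0 <= A -> 0 <= B ->
  \sum_(k < n) a k ^+ 2 <= A ^+ 2 -> \sum_(k < n) b k ^+ 2 <= B ^+ 2 ->
  \sum_(k < n) a k * b k <= A * B.
Proof.
move=> A0 B0 HA HB.
have zero c : \sum_(k < n) c k ^+ 2 <= 0 :> R -> forall k : 'I_n, c k = 0.
  move=> c0 k; apply/eqP; rewrite -sqrf_eq0; apply/eqP.
  have s0 : \sum_(i < n) c i ^+ 2 = 0.
    by apply/eqP; rewrite eq_le c0 sumr_ge0// => i _; rewrite sqr_ge0.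
  by rewrite (psumr_eq0P _ s0)// => i _; exact: sqr_ge0.
have [Az|Az] := eqVneq A 0.
  rewrite Az expr0n/= in HA; rewrite Az mul0r big1// => k _.
  by rewrite (zero _ HA) mul0r.
have [Bz|Bz] := eqVneq B 0.
  rewrite Bz expr0n/= in HB; rewrite Bz mulr0 big1// => k _.
  by rewrite (zero _ HB) mulr0.
have Ap : 0 < A by rewrite lt_neqAle eq_sym Az.
have Bp : 0 < B by rewrite lt_neqAle eq_sym Bz.
have H k : a k * b k <= (B / (2 * A)) * a k ^+ 2 + (A / (2 * B)) * b k ^+ 2.
  rewrite -subr_ge0.
  have -> : B / (2 * A) * a k ^+ 2 + A / (2 * B) * b k ^+ 2 - a k * b k
    = (B * a k - A * b k) ^+ 2 / (2 * A * B) by field; rewrite Az Bz.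
  by rewrite divr_ge0 ?sqr_ge0// !mulr_ge0.
rewrite (le_trans (ler_sum _ (fun k _ => H (nat_of_ord k))))// big_split /= -!mulr_sumr.
have H1 : B / (2 * A) * \sum_(k < n) a k ^+ 2 <= B / (2 * A) * A ^+ 2.
  by rewrite ler_wpM2l// divr_ge0// mulr_ge0.
have H2 : A / (2 * B) * \sum_(k < n) b k ^+ 2 <= A / (2 * B) * B ^+ 2.
  by rewrite ler_wpM2l// divr_ge0// mulr_ge0.
rewrite (le_trans (lerD H1 H2))// le_eqVlt; apply/orP; left; apply/eqP.
by field; rewrite Az Bz.
Qed.

(* The bound on the l2 norm is expressed through partial sums, which avoids all convergence issues. *)
Definition l2_le a M := 0 <= M /\ forall n, \sum_(k < n) a k ^+ 2 <= M ^+ 2.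

Lemma l2_le_dom a b M : (forall k, `|a k| <= b k) -> l2_le b M -> l2_le a M.
Proof.
move=> ab [M0 H]; split=> // n; rewrite (le_trans _ (H n))// ler_sum// => k _.
exact: ler_sqr_norm.
Qed.

Lemma l2_leW a M M' : M <= M' -> l2_le a M -> l2_le a M'.
Proof.
move=> MM [M0 H]; have M'0 := le_trans M0 MM; split=> // n.
by rewrite (le_trans (H n))// ler_pXn2r// nnegrE.
Qed.

Lemma l2_leD a b M M' : l2_le a M -> l2_le b M' -> l2_le (fun k => a k + b k) (M + M').
Proof.
move=> [M0 H] [M'0 H']; split=> [|n]; first exact: addr_ge0.
under eq_bigr do rewrite sqrrD; rewrite !big_split /= sqrrD.
have h3 := cauchy_schwarz_le M0 M'0 (H n) (H' n).
by have := H n; have := H' n; rewrite mulr2n; lra.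
Qed.

Lemma l2_leZ c a M : 0 <= c -> l2_le a M -> l2_le (fun k => c * a k) (c * M).
Proof.
move=> c0 [M0 H]; split=> [|n]; first exact: mulr_ge0.
under eq_bigr do rewrite exprMn; rewrite -mulr_sumr exprMn ler_wpM2l//.
exact: sqr_ge0.
Qed.

Lemma l2_le_sum N (b : nat -> nat -> R) M : 0 <= M ->
  (forall i, (i < N)%N -> l2_le (b i) M) ->
  l2_le (fun k => \sum_(i < N) b i k) (N%:R * M).
Proof.
move=> M0; elim: N => [|N IH] H.
  rewrite mul0r; split=> // n; rewrite expr0n/= big1// => k _.
  by rewrite big_ord0 expr0n.
have := l2_leD (IH (fun i iN => H i (ltnW iN))) (H N (ltnSn N)).
rewrite -[N.+1%:R]natr1 mulrDl mul1r; congr l2_le.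
by apply/funext => k; rewrite big_ord_recr.
Qed.

Lemma l2_le_coord a M k : l2_le a M -> `|a k| <= M.
Proof.
move=> [M0 H]; have := H k.+1; rewrite big_ord_recr /= => h.
rewrite -(@ler_pXn2r _ 2)// ?nnegrE// real_normK ?num_real//.
by rewrite (le_trans _ h)// lerDr sumr_ge0// => i _; rewrite sqr_ge0.
Qed.

Lemma l2_le_sqsum x M : l2_le (fun k => cabs (x k)) M -> in_l2 x /\ l2norm x <= M.
Proof.
move=> [M0 H].
have S : (sqsum x <= (M ^+ 2)%:E)%E.
  apply: lime_le; first by apply: is_cvg_nneseries => k _ _; rewrite lee_fin sqr_ge0.
  by apply: nearW => n; rewrite sumEFin lee_fin big_mkord.
have S0 : (0 <= sqsum x)%E by apply: nneseries_ge0 => k _ _; rewrite lee_fin sqr_ge0.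
have Sf : sqsum x \is a fin_num by rewrite ge0_fin_numE// (le_lt_trans S)// ltry.
split; first by rewrite /in_l2 (le_lt_trans S)// ltry.
rewrite /l2norm -[leRHS](ger0_norm M0) -sqrtr_sqr ler_wsqrtr//.
by rewrite -lee_fin fineK.
Qed.

Lemma sqsum_l2_le x : in_l2 x -> l2_le (fun k => cabs (x k)) (l2norm x).
Proof.
move=> xl2; split=> [|n]; first exact: sqrtr_ge0.
have S0 : (0 <= sqsum x)%E by apply: nneseries_ge0 => k _ _; rewrite lee_fin sqr_ge0.
have Sf : sqsum x \is a fin_num by rewrite ge0_fin_numE.
rewrite /l2norm sqr_sqrtr ?fine_ge0// -lee_fin fineK// -sumEFin.
rewrite -(big_mkord xpredT (fun i => ((cabs (x i) ^+ 2)%:E))).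
by apply: nneseries_lim_ge => k _ _; rewrite lee_fin sqr_ge0.
Qed.

Lemma l2_le_dual n x M : 0 <= M ->
  (forall w, sqs n w <= 1 -> cabs (\sum_(k < n) x k * w k) <= M) ->
  sqs n x <= M ^+ 2.
Proof.
move=> M0 H; set S := sqs n x.
have S0 : 0 <= S by apply: sumr_ge0 => k _; rewrite sqr_ge0.
have [->|Sn] := eqVneq S 0; first exact: sqr_ge0.
have Sp : 0 < S by rewrite lt_neqAle eq_sym Sn.
pose s := Num.sqrt S; have sp : 0 < s by rewrite sqrtr_gt0.
have sS : s ^+ 2 = S by rewrite sqr_sqrtr.
have := H (fun k => (x k)^* * (s^-1)%:C); rewrite /sqs.
under eq_bigr do rewrite cabsM cabsJ cabsR exprMn.
rewrite -mulr_suml -/S real_normK ?num_real// exprVn sS divff// => /(_ (lexx _)).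
under eq_bigr do rewrite mulrA.
rewrite -mulr_suml cabsM cabsR.
have -> : \sum_(k < n) x k * (x k)^* = S%:C.
  rewrite /S rmorph_sum; apply: eq_bigr => k _.
  by rewrite rmorphXn/= cabsE sqr_normc.
rewrite cabsR (gtr0_norm Sp) gtr0_norm ?invr_gt0// -sS expr2 mulfK ?gt_eqF// => sM.
by rewrite -expr2 ler_pXn2r// ?nnegrE// ltW.
Qed.

End L2.

Section Equivalence.
Variables (R : realType) (alpha : R).
Local Notation C := R[i].
Local Notation f := (@f_alpha R alpha).
Local Notation h := (twist alpha).
Local Notation L := (lipc alpha).
Local Notation Omega := (Omega alpha).
Implicit Types (x y w : nat -> C) (z : seqpair R) (M : R).

Let L0 : 0 <= L := lipc_ge0 alpha.

Lemma l2norm_ge0 x : 0 <= l2norm x. Proof. exact: sqrtr_ge0. Qed.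

Lemma l2norm_gt0 x k : in_l2 x -> x k != 0 -> 0 < l2norm x.
Proof.
move=> xl2 xk; have := l2_le_coord k (sqsum_l2_le xl2).
rewrite ger0_norm ?cabs_ge0//; apply: lt_le_trans.
by rewrite cabs_gt0.
Qed.

Lemma OmegaE x k : in_l2 x -> x k != 0 ->
  Omega x k = x k * f (ln (l2norm x) - ln (cabs (x k))).
Proof.
move=> xl2 xk; rewrite /Defs.Omega (negbTE xk) ln_div// posrE ?cabs_gt0//.
exact: l2norm_gt0 xk.
Qed.

Lemma Omega0 x k : x k = 0 -> Omega x k = 0.
Proof. by move=> xk; rewrite /Defs.Omega xk eqxx. Qed.

(** Both terms are [x k * c] times a value of [f]. The Lipschitz bound leaves the distance from
    [ln (cabs (x k) / l2norm x)] to [ln (cabs c)], which [mul_dist_ln_le] turns into squares,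
    weighted so that their sum is of the order of [l2norm x]. *)
Lemma Omega_pair x k (c : C) : in_l2 x ->
  cabs (Omega x k * c - x k * h c) <=
  L * (cabs (x k) ^+ 2 / l2norm x + l2norm x * cabs c ^+ 2).
Proof.
move=> xl2; have N0 := l2norm_ge0 x.
have rhs0 : 0 <= L * (cabs (x k) ^+ 2 / l2norm x + l2norm x * cabs c ^+ 2).
  by apply: mulr_ge0 => //; apply: addr_ge0; [apply: divr_ge0|apply: mulr_ge0]; rewrite ?sqr_ge0.
have [xk|xk] := eqVneq (x k) 0.
  by move: rhs0; rewrite Omega0// xk !mul0r subrr cabs0.
have [c0|c0] := eqVneq c 0.
  by move: rhs0; rewrite c0 twist0 !mulr0 subrr cabs0.
have Np := l2norm_gt0 xl2 xk; set N := l2norm x in Np N0 rhs0 *.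
have xp : 0 < cabs (x k) by rewrite cabs_gt0.
have cp : 0 < cabs c by rewrite cabs_gt0.
rewrite OmegaE// -/N /twist.
rewrite (_ : _ - _ = x k * c * (f (ln N - ln (cabs (x k))) - f (- ln (cabs c)))); last by ring.
rewrite cabsM cabsM (le_trans (ler_wpM2l _ (f_alpha_lip _ _ _)))//.
  by rewrite mulr_ge0 ?cabs_ge0.
rewrite mulrCA ler_wpM2l//.
have -> : `|ln N - ln (cabs (x k)) - - ln (cabs c)| = `|ln (cabs (x k) / N) - ln (cabs c)|.
  by rewrite ln_div ?posrE// -normrN; congr (`|_|); ring.
have := mul_dist_ln_le (divr_gt0 xp Np) cp => H.
have -> : cabs (x k) * cabs c * `|ln (cabs (x k) / N) - ln (cabs c)| =
  (N * cabs c) * (cabs (x k) / N * `|ln (cabs (x k) / N) - ln (cabs c)|).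
  by field; rewrite gt_eqF.
rewrite (le_trans (ler_wpM2l _ H))//; first by rewrite mulr_ge0// ltW.
rewrite le_eqVlt; apply/orP; left; apply/eqP; field.
by rewrite !gt_eqF.
Qed.

Lemma Omega_pair_sum n x w : in_l2 x -> sqs n w <= 1 ->
  cabs (\sum_(k < n) (Omega x k * w k - x k * h (w k))) <= 2 * L * l2norm x.
Proof.
move=> xl2 w1; rewrite (le_trans (cabs_sum _ _ _))//.
rewrite (le_trans (ler_sum _ (fun (k : 'I_n) _ => Omega_pair k (w k) xl2)))//.
rewrite -mulr_sumr big_split /= -mulr_suml -mulr_sumr (mulrC 2) -mulrA ler_wpM2l//.
have N0 := l2norm_ge0 x; have [_ /(_ n) Hx] := sqsum_l2_le xl2.
have H2 : l2norm x * \sum_(i < n) cabs (w i) ^+ 2 <= l2norm x by rewrite ler_piMr.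
have H1 : (\sum_(i < n) cabs (x i) ^+ 2) / l2norm x <= l2norm x.
  have [->|Nn] := eqVneq (l2norm x) 0; first by rewrite invr0 mulr0.
  by rewrite ler_pdivrMr ?lt_neqAle 1?eq_sym ?Nn// -expr2.
by lra.
Qed.

Lemma cauchy_schwarz_cabs n x w M : l2_le (fun k => cabs (x k)) M -> sqs n w <= 1 ->
  cabs (\sum_(k < n) x k * w k) <= M.
Proof.
move=> [M0 H] w1; rewrite (le_trans (cabs_sum _ _ _))//.
under eq_bigr do rewrite cabsM.
rewrite -[leRHS]mulr1.
by apply: (@cauchy_schwarz_le _ n (fun k => cabs (x k)) (fun k => cabs (w k))); rewrite ?expr1n.
Qed.

Lemma test_le_Znorm z : in_Z alpha z -> test_le alpha z ((1 + 2 * L) * Znorm alpha z).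
Proof.
move=> [x2 d2] n v w v1 w1; set N := l2norm z.1.
set D := l2norm (fun k => z.2 k - Omega z.1 k).
have N0 : 0 <= N := l2norm_ge0 _; have D0 : 0 <= D := l2norm_ge0 _.
have -> : test alpha n v w z = \sum_(k < n) z.1 k * v k +
    (\sum_(k < n) (z.2 k - Omega z.1 k) * w k +
     \sum_(k < n) (Omega z.1 k * w k - z.1 k * h (w k))).
  by rewrite /test -!big_split; apply: eq_bigr => k _ /=; ring.
have H1 := cauchy_schwarz_cabs (sqsum_l2_le x2) v1.
have H2 := cauchy_schwarz_cabs (sqsum_l2_le d2) w1.
have H3 := Omega_pair_sum x2 w1.
rewrite (le_trans (cabsD _ _))// (le_trans (lerD H1 (le_trans (cabsD _ _) (lerD H2 H3))))//.
rewrite /Znorm -/N -/D.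
have : 0 <= L * D by rewrite mulr_ge0.
by lra.
Qed.

(** Tests with [w = 0] see only [z.1] and bound its l2 norm; then tests with [v = 0] bound
    [z.2 - Omega z.1], up to the error in [Omega_pair_sum]. *)
Lemma test_le_in_Z z M : test_le alpha z M ->
  in_Z alpha z /\ Znorm alpha z <= (2 + 2 * L) * M.
Proof.
move=> H; have M0 : 0 <= M := le_trans (cabs_ge0 _) (test_le_coord1 0 H).
have Hx : l2_le (fun k => cabs (z.1 k)) M.
  split=> // n; apply: (@l2_le_dual _ n z.1) => // w w1.
  have := H n w (fun=> 0) w1; rewrite sqs0 => /(_ ler01); congr (cabs _ <= _).
  by apply: eq_bigr => k _; rewrite twist0 subr0 mulr0 addr0.
have [x2 NM] := l2_le_sqsum Hx.
have Hd : l2_le (fun k => cabs (z.2 k - Omega z.1 k)) ((1 + 2 * L) * M).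
  have K0 : 0 <= (1 + 2 * L) * M by rewrite mulr_ge0// addr_ge0// mulr_ge0.
  split=> // n; apply: (@l2_le_dual _ n (fun k => z.2 k - Omega z.1 k)) => // w w1.
  have -> : \sum_(k < n) (z.2 k - Omega z.1 k) * w k =
     test alpha n (fun=> 0) w z - \sum_(k < n) (Omega z.1 k * w k - z.1 k * h (w k)).
    by rewrite /test -sumrB; apply: eq_bigr => k _ /=; ring.
  rewrite (le_trans (cabsD _ _))// cabsN.
  have H1 : cabs (test alpha n (fun=> 0) w z) <= M by apply: H => //; rewrite sqs0.
  have H3 := Omega_pair_sum x2 w1.
  have : L * l2norm z.1 <= L * M by rewrite ler_wpM2l.
  by lra.
have [d2 DM] := l2_le_sqsum Hd.
split; first by split.
by rewrite /Znorm; lra.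
Qed.

Lemma Omega_twist x k : in_l2 x ->
  cabs (Omega x k - h (x k)) <= L * `|ln (l2norm x)| * cabs (x k).
Proof.
move=> xl2; have [xk|xk] := eqVneq (x k) 0.
  by rewrite Omega0// xk twist0 subrr cabs0 mulr0.
rewrite OmegaE// /twist -mulrBr cabsM mulrC ler_wpM2r ?cabs_ge0//.
by rewrite (le_trans (f_alpha_lip _ _ _))// opprK subrK.
Qed.

Lemma l2_Omega_twist x : in_l2 x ->
  l2_le (fun k => cabs (Omega x k - h (x k))) (L * (l2norm x * `|ln (l2norm x)|)).
Proof.
move=> xl2; rewrite mulrA mulrAC.
apply: l2_le_dom (l2_leZ _ (sqsum_l2_le xl2)); last by rewrite mulr_ge0.
by move=> k; rewrite ger0_norm ?cabs_ge0//; exact: Omega_twist.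
Qed.

Lemma xlnx_le (t : R) : 0 <= t -> t * `|ln t| <= 1 + t ^+ 2.
Proof.
rewrite le_eqVlt => /predU1P[<-|t0]; first by rewrite mul0r addr_ge0// sqr_ge0.
by have := mul_dist_ln_le t0 ltr01; rewrite ln1 subr0 divr1.
Qed.

Lemma l2_le_Znorm z K : in_Z alpha z -> Znorm alpha z <= K ->
  l2_le (fun k => cabs (z.1 k)) K /\
  l2_le (fun k => cabs (z.2 k - h (z.1 k))) (K + L * (1 + K ^+ 2)).
Proof.
move=> [x2 d2] zK; rewrite /Znorm in zK.
have N0 := l2norm_ge0 z.1; have D0 := l2norm_ge0 (fun k => z.2 k - Omega z.1 k).
have NK : l2norm z.1 <= K by lra.
have DK : l2norm (fun k => z.2 k - Omega z.1 k) <= K by lra.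
split; first exact: l2_leW NK (sqsum_l2_le x2).
apply: l2_le_dom (l2_leD (l2_leW DK (sqsum_l2_le d2)) (l2_leW _ (l2_Omega_twist x2))).
  by move=> k; rewrite ger0_norm ?cabs_ge0// cabs_distD.
rewrite ler_wpM2l// (le_trans (xlnx_le N0))// lerD2l ler_pXn2r// ?nnegrE//.
exact: le_trans NK.
Qed.

Lemma xlnx_small (eta : R) : 0 < eta ->
  exists2 c, 0 < c & forall t, 0 <= t <= c -> t * `|ln t| <= eta.
Proof.
(* The choice of [c] keeps each of the terms [b], [t ^+ 2 / b] and [t * |ln b|] below [b], a third
   of [eta]. *)
move=> eta0; pose b := eta / 3; have b0 : 0 < b by rewrite divr_gt0.
have l0 : 0 < 1 + `|ln b| by rewrite ltr_pwDl.
pose c := Num.min b (b / (1 + `|ln b|)).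
exists c; first by rewrite lt_min b0 divr_gt0.
move=> t /andP[]; rewrite le_eqVlt => /predU1P[<-|t0]; first by move=> _; rewrite mul0r ltW.
rewrite le_min => /andP[tb]; rewrite ler_pdivlMr// mulrDr mulr1 => tl.
have := mul_dist_ln_le t0 b0.
have : t ^+ 2 / b <= b by rewrite ler_pdivrMr// expr2; apply: ler_pM => //; exact: ltW.
have : t * `|ln t| <= t * `|ln t - ln b| + t * `|ln b|.
  rewrite -mulrDr; apply: ler_wpM2l; first exact: ltW.
  by rewrite -lerBlDr; exact: lerB_dist.
have : eta = b + b + b by rewrite /b; lra.
by lra.
Qed.

(** The way back from [twist] to [Omega]: with [N] the l2 norm, the normalisation costs a multiple
    of [N * |ln N|], which vanishes with [N]. *)
Lemma Znorm_small (eta : R) : 0 < eta ->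
  exists2 c, 0 < c & forall z, in_Z alpha z ->
    l2_le (fun k => cabs (z.1 k)) c ->
    l2_le (fun k => cabs (z.2 k - h (z.1 k))) c -> Znorm alpha z <= eta.
Proof.
move=> eta0; have e3 : 0 < eta / 3 by rewrite divr_gt0.
have L1 := lipc_gt0 alpha.
have [c1 c10 Hc1] := xlnx_small (divr_gt0 e3 L1).
exists (Num.min c1 (eta / 3)); first by rewrite lt_min c10.
set c := Num.min _ _.
have cc : c <= c1 by rewrite ge_min lexx.
have ce : c <= eta / 3 by rewrite ge_min lexx orbT.
move=> z [x2 d2] Hx Hd; have [_ N1] := l2_le_sqsum Hx.
have N0 := l2norm_ge0 z.1.
have lN : L * (l2norm z.1 * `|ln (l2norm z.1)|) <= eta / 3.
  rewrite mulrC -ler_pdivlMr//; apply: Hc1; rewrite N0/=; exact: le_trans cc.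
have : l2_le (fun k => cabs (z.2 k - Omega z.1 k)) (eta / 3 + eta / 3).
  apply: l2_le_dom (l2_leD (l2_leW ce Hd) (l2_leW lN (l2_Omega_twist x2))).
  by move=> k; rewrite ger0_norm ?cabs_ge0// (cabsB (Omega z.1 k)) cabs_distD.
by move=> /l2_le_sqsum[_]; rewrite /Znorm; lra.
Qed.

End Equivalence.

(** * Subsequences and signs *)

Section Subsequences.

Definition increasing (kappa : nat -> nat) := {homo kappa : i j / (i < j)%N}.

Lemma increasing_ge kappa i : increasing kappa -> (i <= kappa i)%N.
Proof.
move=> H; elim: i => // i IH; apply: leq_ltn_trans IH _; exact: H.
Qed.

Lemma increasing_comp k1 k2 : increasing k1 -> increasing k2 -> increasing (k1 \o k2).
Proof. by move=> H1 H2 i j ij /=; apply: H1; exact: H2. Qed.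

Lemma increasing_step kappa : (forall i, (kappa i < kappa i.+1)%N) -> increasing kappa.
Proof.
move=> H i j; elim: j => // j IH; rewrite ltnS leq_eqVlt => /predU1P[->|/IH h].
  exact: H.
exact: ltn_trans h (H j).
Qed.

(** Indices of failure, if infinitely many, would form a subsequence without a good index. Averaging
    only provides one good index in each subsequence; this upgrades it to all large indices. *)
Lemma eventually_of_subsequences (good : nat -> Prop) :
  (forall kappa, increasing kappa -> exists i, good (kappa i)) ->
  exists i0, forall i, (i0 <= i)%N -> good i.
Proof.
move=> H; apply: contrapT => nH.
have /choice[g Hg] : forall i0, exists i, (i0 <= i)%N /\ ~ good i.
  move=> i0; apply: contrapT => n0; apply: nH; exists i0 => i i0i.
  by apply: contrapT => ni; apply: n0; exists i.
pose kappa := fix kappa n := if n is m.+1 then g (kappa m).+1 else g 0%N.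
have [|i] := H kappa.
  by apply: increasing_step => i /=; have [] := Hg (kappa i).+1.
by case: i => [|i] /=; [have [] := Hg 0%N|have [] := Hg (kappa i).+1].
Qed.

End Subsequences.

(** * Averaging over signs and gliding humps *)

Section Combinatorics.
Variable R : realType.
Local Notation C := R[i].
Local Notation l2c x M := (l2_le (fun j => cabs (x j)) M).

Lemma sqs_ge0 n (x : nat -> C) : 0 <= sqs n x.
Proof. by apply: sumr_ge0 => k _; rewrite sqr_ge0. Qed.

Lemma sqs_le m n (x : nat -> C) : (m <= n)%N -> sqs m x <= sqs n x.
Proof.
move=> mn; rewrite /sqs -!(big_mkord xpredT (fun i => cabs (x i) ^+ 2)).
rewrite [leRHS](big_cat_nat (n := m))//= lerDl sumr_ge0// => i _; exact: sqr_ge0.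
Qed.

Lemma sqs_parallelogram n (x y : nat -> C) :
  sqs n (fun j => x j + y j) + sqs n (fun j => x j - y j) = 2 * sqs n x + 2 * sqs n y.
Proof.
rewrite /sqs !mulr_sumr -!big_split; apply: eq_bigr => j _ /=.
exact: cabs_parallelogram.
Qed.

Definition signs (eps : nat -> C) := forall i, eps i = 1 \/ eps i = -1.

Lemma cabs_signs eps i : signs eps -> cabs (eps i) = 1.
Proof. by move=> /(_ i)[]->; rewrite ?cabsN cabs1. Qed.

(** Signs are chosen greedily: by the parallelogram law, one of [S + x] and [S - x] has squared norm
    at least that of [S] plus that of [x]. *)
Lemma exists_signs n N (x : nat -> nat -> C) : exists2 eps, signs eps &
  \sum_(i < N) sqs n (x i) <= sqs n (fun j => \sum_(i < N) eps i * x i j).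
Proof.
elim: N => [|N [eps Heps IH]].
  by exists (fun=> 1); [left|rewrite big_ord0 sqs_ge0].
pose S j := \sum_(i < N) eps i * x i j.
have P := sqs_parallelogram n S (x N).
have ext (e : C) : e = 1 \/ e = -1 ->
    \sum_(i < N) sqs n (x i) + sqs n (x N) <= sqs n (fun j => S j + e * x N j) ->
    exists2 eps, signs eps &
    \sum_(i < N.+1) sqs n (x i) <= sqs n (fun j => \sum_(i < N.+1) eps i * x i j).
  move=> He Hle; exists (fun i => if i == N then e else eps i).
    by move=> i /=; case: ifP.
  rewrite big_ord_recr /= (le_trans Hle)// le_eqVlt; apply/orP; left; apply/eqP.
  congr sqs; apply/funext => j; rewrite big_ord_recr /= eqxx; congr (_ + _).
  by apply: eq_bigr => i _; rewrite ltn_eqF.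
case: (leP (sqs n S + sqs n (x N)) (sqs n (fun j => S j + x N j))) => h.
  apply: (ext 1); first by left.
  have -> : (fun j => S j + 1 * x N j) = (fun j => S j + x N j).
    by apply/funext => j; rewrite mul1r.
  by rewrite (le_trans _ h)// lerD2r.
apply: (ext (-1)); first by right.
have -> : (fun j => S j + -1 * x N j) = (fun j => S j - x N j).
  by apply/funext => j; rewrite mulN1r.
by move: IH; rewrite -/S; lra.
Qed.

(** If all summands had norm above [2 * M], the signs from [exists_signs] would give a sum of
    squared norm at least [c ^+ 2 * N * (2 * M) ^+ 2], hence at least [2 * M ^+ 2]. *)
Lemma exists_bounded_summand (N : nat) (c M : R) (x : nat -> nat -> C) :
  (0 < N)%N -> 1 <= 2 * (c ^+ 2 * N%:R) ->
  (forall eps, signs eps -> l2c (fun j => \sum_(i < N) c%:C * eps i * x i j) M) ->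
  exists2 i, (i < N)%N & l2c (x i) (2 * M).
Proof.
move=> N0 cN H.
have M0 : 0 <= M by have [] := H (fun=> 1) (fun=> or_introl erefl).
apply: contrapT => nex.
have /choice[n Hn] : forall i : nat, exists n, (i < N)%N -> (2 * M) ^+ 2 < sqs n (x i).
  move=> i; case: (ltnP i N) => iN; last by exists 0%N.
  apply: contrapT => nn; apply: nex; exists i => //; split; first by rewrite mulr_ge0.
  by move=> n; rewrite leNgt; apply/negP => h; apply: nn; exists n.
(* [exists_signs] concerns partial sums of one length, so all the violations are moved to a common
   one. *)
pose m := \max_(i < N) n i.
have Hm (i : 'I_N) : (2 * M) ^+ 2 < sqs m (x i).
  by rewrite (lt_le_trans (Hn i (ltn_ord i)))// sqs_le// /m (leq_bigmax i).
have [eps Heps Hs] := exists_signs m N x.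
have [_ /(_ m)] := H eps Heps.
have -> : \sum_(k < m) cabs (\sum_(i < N) c%:C * eps i * x i k) ^+ 2 =
   c ^+ 2 * sqs m (fun j => \sum_(i < N) eps i * x i j).
  rewrite /sqs mulr_sumr; apply: eq_bigr => k _.
  under eq_bigr do rewrite -mulrA.
  by rewrite -mulr_sumr cabsM cabsR exprMn real_normK ?num_real.
have : (2 * M) ^+ 2 * N%:R < \sum_(i < N) sqs m (x i).
  have -> : (2 * M) ^+ 2 * N%:R = \sum_(i < N) (2 * M) ^+ 2.
    by rewrite sumr_const card_ord mulr_natr.
  apply: ltr_sum; last by move=> i _; exact: Hm.
  by apply/hasP; exists (Ordinal N0); rewrite ?mem_index_enum.
set S := \sum_(i < N) _ in Hs *; set T := sqs m _ in Hs *.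
move=> h1 h2.
have c2 : 0 < c ^+ 2.
  rewrite lt_neqAle sqr_ge0 andbT eq_sym; apply/eqP => c0.
  by move: cN; rewrite c0 mul0r mulr0 ler10.
have h3 : c ^+ 2 * ((2 * M) ^+ 2 * N%:R) < M ^+ 2.
  by rewrite (lt_le_trans _ h2)// ltr_pM2l// (lt_le_trans h1).
have := ler_wpM2r (sqr_ge0 M) cN; rewrite mul1r.
move: h3; rewrite exprMn; have := sqr_ge0 M; lra.
Qed.

Lemma l2_le_tail (a : nat -> R) (M eta : R) (n0 : nat) : l2_le a M -> 0 < eta ->
  exists2 n, (n0 <= n)%N & forall m, \sum_(j < m) (if (n <= j)%N then a j ^+ 2 else 0) <= eta.
Proof.
move=> [M0 H] eta0; pose S n := \sum_(j < n) a j ^+ 2.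
have Smono m n : (m <= n)%N -> S m <= S n.
  move=> mn; rewrite /S -!(big_mkord xpredT (fun i => a i ^+ 2)).
  rewrite [leRHS](big_cat_nat (n := m))//= lerDl sumr_ge0// => i _; exact: sqr_ge0.
have hs : has_sup (range S).
  split; first by exists (S 0%N); exists 0%N.
  by exists (M ^+ 2) => _ [n _ <-]; exact: H.
have [_ [n _ <-] Sn] := sup_adherent eta0 hs.
have Sub m : S m <= sup (range S) by apply: sup_upper_bound => //; exists m.
exists (maxn n0 n); first exact: leq_maxl.
move=> m; set n' := maxn n0 n.
have nn' : S n <= S n' by apply: Smono; exact: leq_maxr.
case: (leqP n' m) => mn; last first.
  rewrite big1 ?ltW// => j _; rewrite leqNgt ifF//.
  by apply/negbF; rewrite (leq_trans (ltn_ord j))// ltnW.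
rewrite -(big_mkord xpredT (fun j => if (n' <= j)%N then a j ^+ 2 else 0)).
rewrite (big_cat_nat (n := n'))//= big_nat big1 ?add0r; last first.
  by move=> j /andP[_ jn]; rewrite leqNgt jn.
have : S m = S n' + \sum_(n' <= j < m) a j ^+ 2.
  rewrite /S -!(big_mkord xpredT (fun i => a i ^+ 2)) (big_cat_nat (n := n'))//=.
have -> : \sum_(n' <= i < m) (if (n' <= i)%N then a i ^+ 2 else 0) = \sum_(n' <= i < m) a i ^+ 2.
  by apply: eq_big_nat => j /andP[->].
by have := Sub m; lra.
Qed.

(** Each new [u k] is taken so late that its head, up to the previous interval, is small; the
    interval is then extended until the tail is small. Head and tail get half of [delta ^+ 2]
    each. *)
Lemma gliding_hump (u : nat -> nat -> C) (M delta : R) (P : nat -> Prop) :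
  0 < delta -> (forall k, l2c (u k) M) ->
  (forall n (eta : R), 0 < eta -> exists k0, forall k, (k0 <= k)%N -> sqs n (u k) <= eta) ->
  (exists k0, forall k, (k0 <= k)%N -> P k) ->
  exists (kappa J : nat -> nat), [/\ increasing kappa, increasing J,
    (forall i, P (kappa i)) &
    forall i, l2c (fun j => if (J i <= j < J i.+1)%N then 0 else u (kappa i) j) delta].
Proof.
move=> d0 Hu Hn [k0 HP].
have d2 : 0 < delta ^+ 2 / 2 by rewrite divr_gt0 ?exprn_gt0.
have /choice[F HF] : forall Mn : nat * nat, exists kn : nat * nat,
    [/\ (Mn.1 <= kn.1)%N, (Mn.2 < kn.2)%N, P kn.1 &
     l2c (fun j => if (Mn.2 <= j < kn.2)%N then 0 else u kn.1 j) delta].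
  move=> [m n] /=; have [k1 Hk1] := Hn n _ d2.
  pose k := maxn m (maxn k0 k1).
  have [n' nn' Hn'] := l2_le_tail n.+1 (Hu k) d2.
  exists (k, n'); split => //=; first exact: leq_maxl.
    by apply: HP; rewrite /k !leq_max leqnn orbT.
  split=> [|l]; first exact: ltW.
  have sm : sqs n (u k) <= delta ^+ 2 / 2 by apply: Hk1; rewrite /k !leq_max leqnn !orbT.
  have -> : delta ^+ 2 = delta ^+ 2 / 2 + delta ^+ 2 / 2 by lra.
  have head_le : \sum_(j < l) (if (j < n)%N then cabs (u k j) ^+ 2 else 0) <= sqs n (u k).
    have -> : \sum_(j < l) (if (j < n)%N then cabs (u k j) ^+ 2 else 0) = sqs (minn l n) (u k).
      elim: l => [|l IH]; first by rewrite min0n /sqs !big_ord0.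
      rewrite big_ord_recr /= IH; case: ltnP => ln.
        by rewrite (minn_idPl ln) /sqs big_ord_recr.
      by rewrite addr0 (minn_idPr (leqW ln)).
    by rewrite sqs_le// geq_minr.
  rewrite (le_trans _ (lerD (le_trans head_le sm) (Hn' l)))// -big_split /=.
  apply: ler_sum => j _; case: ifP => [_|].
    by rewrite cabs0 expr0n addr_ge0//; case: ifP => // _; rewrite sqr_ge0.
  move=> /negbT; rewrite negb_and -ltnNge -leqNgt => /orP[->|->].
    by rewrite lerDl; case: ifP => // _; rewrite sqr_ge0.
  by rewrite lerDr; case: ifP => // _; rewrite sqr_ge0.
(* The state is the least index still allowed and the right end of the last interval; the successor
   makes the chosen indices strictly increasing. *)
pose st := fix st i := if i is i'.+1 then
   let kn := F (st i') in (kn.1.+1, kn.2) else (0%N, 0%N).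
exists (fun i => (F (st i)).1), (fun i => (st i).2); split.
- apply: increasing_step => i /=; have [h _ _ _] := HF (st i.+1).
  exact: h.
- by apply: increasing_step => i /=; have [_ h _ _] := HF (st i).
- by move=> i; have [] := HF (st i).
- by move=> i; have [] := HF (st i).
Qed.

End Combinatorics.

(** * Images of blocks *)

Section Pointwise.
Variables (R : realType) (alpha : R).
Local Notation C := R[i].
Local Notation f := (@f_alpha R alpha).
Local Notation h := (twist alpha).
Local Notation L := (lipc alpha).
Local Notation incr := (incr alpha).

Let L0 : 0 <= L := lipc_ge0 alpha.

Lemma twist_sum_disjoint N (a : nat -> C) :
  (forall i j, a i != 0 -> a j != 0 -> i = j) ->
  h (\sum_(i < N) a i) = \sum_(i < N) h (a i).
Proof.
move=> H; case: (pickP (fun i : 'I_N => a i != 0)) => [i ai|az].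
  have z (j : 'I_N) : j != i -> a j = 0.
    move=> ji; apply/eqP; apply: contraNT ji => aj.
    by apply/eqP/val_inj; exact: H.
  rewrite (bigD1 i)//= big1 ?addr0; last by move=> j ji; exact: z.
  rewrite [RHS](bigD1 i)//= big1 ?addr0// => j ji.
  by rewrite z// twist0.
have z (j : 'I_N) : a j = 0 by apply/eqP; rewrite -[_ == _]negbK az.
by rewrite !big1 ?twist0// => j _; rewrite z ?twist0.
Qed.

Lemma twist_shift s (e x : C) : cabs e = 1 ->
  h ((expR (- s))%:C * e * x) =
  (expR (- s))%:C * e * (h x + incr s (- ln (cabs x)) * x).
Proof.
move=> e1; have [->|x0] := eqVneq x 0; first by rewrite !mulr0 twist0 addr0 mulr0.
have cx : 0 < cabs x by rewrite cabs_gt0.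
rewrite /twist !cabsM e1 mulr1 cabsR gtr0_norm ?expR_gt0// lnM ?posrE ?expR_gt0// expRK.
rewrite incrE opprD opprK [s + _]addrC; ring.
Qed.

Lemma twist_mul_le (a : R) (z w : C) : cabs z <= 1 -> cabs z * `|ln (cabs z)| <= a ->
  cabs (h (z * w) - z * h w) <= L * a * cabs w.
Proof.
move=> z1 za; rewrite (le_trans (twist_mul _ _ _))// ler_wpM2r ?cabs_ge0//.
by rewrite ler_wpM2l.
Qed.

Lemma twist_lincomb N (a : R) (z : nat -> C) (y : nat -> C) :
  (forall i, cabs (z i) <= 1) -> (forall i, cabs (z i) * `|ln (cabs (z i))| <= a) ->
  cabs (h (\sum_(i < N) z i * y i) - \sum_(i < N) z i * h (y i)) <=
  L * (7 * N%:R + a) * \sum_(i < N) cabs (y i).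
Proof.
move=> z1 za.
set B := \sum_(i < N) z i * y i.
rewrite (_ : _ - _ = (h B - \sum_(i < N) h (z i * y i)) +
   \sum_(i < N) (h (z i * y i) - z i * h (y i))); last by rewrite sumrB; ring.
rewrite (le_trans (cabsD _ _))// mulrDr mulrDl; apply: lerD.
  rewrite (le_trans (@twist_sum _ alpha N (fun i => z i * y i)))//.
  rewrite [L * _]mulrCA -[7 * L * N%:R]mulrA; apply: ler_wpM2l.
    by rewrite !mulr_ge0.
  by apply: ler_sum => i _; rewrite cabsM ler_piMl ?cabs_ge0.
rewrite (le_trans (cabs_sum _ _ _))// mulr_sumr; apply: ler_sum => i _.
exact: twist_mul_le.
Qed.

(** At a single coordinate, [U] splits into the humps, the rest of the [u i] and the [p i]. At most
    one hump is nonzero, so [twist] is exact on that part; the others cost multiples of their size.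
    Joining the parts takes [twistD] twice, whence the term [14 * L * cabs U]. *)
Lemma twist_perturbation s N (e u p : nat -> C) (w : nat -> bool) (c U : C) :
  1 <= s -> (forall i, cabs (e i) = 1) ->
  (forall i j, w i -> w j -> i = j) ->
  c = (expR (- s))%:C ->
  U = \sum_(i < N) c * e i * (u i + conjc (f s) * p i) ->
  cabs (h U - \sum_(i < N) c * e i *
      (h (u i) + conjc (f s) * h (p i) +
       (if w i then incr s (- ln (cabs (u i))) * u i else 0))) <=
  14 * L * cabs U +
  L * (30 + 14 * N%:R + s) * \sum_(i < N) (cabs (if w i then 0 else u i) + cabs (p i)).
Proof.
move=> s1 He Hw cE' U'E.
have s0 : 0 < s := lt_le_trans ltr01 s1.
have ces i : cabs (c * e i) = expR (- s).
  by rewrite cabsM He mulr1 cE' cabsR gtr0_norm ?expR_gt0.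
have cE : expR (- s) <= 1 by rewrite expR_le1 oppr_le0 ltW.
have csE : expR (- s) * s <= 1.
  rewrite expRN mulrC ler_pdivrMr ?expR_gt0// mul1r.
  by rewrite (le_trans _ (expR_ge1Dx s))// lerDr.
have fs : cabs (conjc (f s)) = s by rewrite cabsJ cabs_f gtr0_norm.
pose u1 i := if w i then u i else 0; pose u2 i := if w i then 0 else u i.
have u12 i : u i = u1 i + u2 i by rewrite /u1 /u2; case: ifP; rewrite ?addr0 ?add0r.
have hu i : h (u i) = h (u1 i) + h (u2 i).
  by rewrite /u1 /u2; case: ifP; rewrite twist0 ?addr0 ?add0r.
pose A := \sum_(i < N) c * e i * u1 i.
pose B := \sum_(i < N) c * e i * u2 i.
pose G := \sum_(i < N) c * e i * conjc (f s) * p i.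
have UE : U = A + B + G.
  by rewrite U'E /A /B /G -!big_split; apply: eq_bigr => i _; rewrite u12 /=; ring.
pose TB := \sum_(i < N) cabs (u2 i); pose TG := \sum_(i < N) cabs (p i).
have TE : \sum_(i < N) (cabs (if w i then 0 else u i) + cabs (p i)) = TB + TG.
  by rewrite big_split.
have hA : h A = \sum_(i < N) c * e i *
    (h (u1 i) + (if w i then incr s (- ln (cabs (u i))) * u i else 0)).
  rewrite /A (@twist_sum_disjoint N (fun i => c * e i * u1 i)); last first.
    move=> i j; rewrite !mulf_eq0 !negb_or /u1 => /andP[_ hi] /andP[_ hj].
    by move: hi hj; do 2 (case: ifP; rewrite ?eqxx//); move=> *; exact: Hw.
  apply: eq_bigr => i _; rewrite cE' twist_shift// /u1; case: ifP => // _.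
  by rewrite mulr0.
have hB : cabs (h B - \sum_(i < N) c * e i * h (u2 i)) <= L * (7 * N%:R + s) * TB.
  apply: (@twist_lincomb N s (fun i => c * e i) u2) => i; rewrite ces//.
  by rewrite expRK normrN gtr0_norm// ler_piMl// ltW.
have hG : cabs (h G - \sum_(i < N) c * e i * conjc (f s) * h (p i)) <= L * (7 * N%:R + 2) * TG.
  have cs i : cabs (c * e i * conjc (f s)) = expR (- s) * s by rewrite cabsM ces fs.
  apply: (@twist_lincomb N 2 (fun i => c * e i * conjc (f s)) p) => i; rewrite cs//.
  have es0 : 0 <= expR (- s) * s by rewrite mulr_ge0 ?expR_ge0// ltW.
  rewrite (le_trans (xlnx_le es0))//.
  have e21 : (expR (- s) * s) ^+ 2 <= 1 by rewrite expr_le1.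
  lra.
have TB0 : 0 <= TB by apply: sumr_ge0 => i _; exact: cabs_ge0.
have TG0 : 0 <= TG by apply: sumr_ge0 => i _; exact: cabs_ge0.
have cB : cabs B <= TB.
  rewrite (le_trans (cabs_sum _ _ _))//; apply: ler_sum => i _.
  by rewrite cabsM ces ler_piMl ?cabs_ge0.
have cG : cabs G <= TG.
  rewrite (le_trans (cabs_sum _ _ _))//; apply: ler_sum => i _.
  by rewrite cabsM cabsM ces fs ler_piMl ?cabs_ge0.
have cA : cabs A <= cabs U + TB + TG.
  have -> : A = U - B - G by rewrite UE; ring.
  have := cabsD (U - B) (- G); have := cabsD U (- B); rewrite !cabsN; lra.
rewrite TE.
have -> : h U - \sum_(i < N) c * e i * (h (u i) + conjc (f s) * h (p i) +
       (if w i then incr s (- ln (cabs (u i))) * u i else 0)) =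
  (h (A + B + G) - h (A + B) - h G) + (h (A + B) - h A - h B) +
  (h B - \sum_(i < N) c * e i * h (u2 i)) +
  (h G - \sum_(i < N) c * e i * conjc (f s) * h (p i)).
  rewrite UE hA.
  have -> : \sum_(i < N) c * e i * (h (u i) + conjc (f s) * h (p i) +
       (if w i then incr s (- ln (cabs (u i))) * u i else 0)) =
    \sum_(i < N) c * e i * (h (u1 i) + (if w i then incr s (- ln (cabs (u i))) * u i else 0)) +
    \sum_(i < N) c * e i * h (u2 i) + \sum_(i < N) c * e i * conjc (f s) * h (p i).
    by rewrite -!big_split; apply: eq_bigr => i _; rewrite hu /=; ring.
  by ring.
set Z1 := h (A + B + G) - _ - _; set Z2 := h (A + B) - _ - _.
set Z3 := h B - _; set Z4 := h G - _.
have k1 : cabs Z1 <= 7 * L * (cabs (A + B) + cabs G) by exact: twistD.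
have k2 : cabs Z2 <= 7 * L * (cabs A + cabs B) by exact: twistD.
have kAB := cabsD A B.
have k12 : cabs Z1 + cabs Z2 <= L * (7 * (cabs (A + B) + cabs G) + 7 * (cabs A + cabs B)).
  by rewrite (le_trans (lerD k1 k2))// le_eqVlt; apply/orP; left; apply/eqP; ring.
have N0 : 0 <= N%:R :> R by [].
have NB := mulr_ge0 N0 TB0; have NG := mulr_ge0 N0 TG0.
have sB := mulr_ge0 (ltW s0) TB0; have sG := mulr_ge0 (ltW s0) TG0.
have -> : 14 * L * cabs U + L * (30 + 14 * N%:R + s) * (TB + TG) =
  L * (7 * (cabs U + TB + TG + TB + TG) + 7 * (cabs U + TB + TG + TB)) +
  L * (7 * N%:R + s) * TB + L * (7 * N%:R + 2) * TG +
  L * (2 * TB + 7 * TG + 7 * (N%:R * TB) + 7 * (N%:R * TG) + s * TG) by ring.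
rewrite (le_trans (cabsD _ _))//.
rewrite (le_trans (lerD (le_trans (cabsD _ _) (lerD (le_trans (cabsD _ _) k12) hB)) hG))//.
rewrite -[leLHS]addr0; apply: lerD; last by apply: mulr_ge0 => //; lra.
by do 2 (apply: lerD => //); apply: ler_wpM2l => //; lra.
Qed.

End Pointwise.

(** * Smallness of the images of the unit vectors *)

Section Blocks.
Variables (R : realType) (alpha : R).
Local Notation C := R[i].
Local Notation f := (@f_alpha R alpha).
Local Notation h := (twist alpha).
Local Notation L := (lipc alpha).
Local Notation incr := (incr alpha).
Local Notation l2c x M := (l2_le (fun j => cabs (x j)) M).

Let L0 : 0 <= L := lipc_ge0 alpha.
Let L1 : 1 <= L := lipc_ge1 alpha.

(** For [s >= 0], this many coefficients of modulus [expR (- s)] have l2 norm between [1 / sqrt 2]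
    and 1. *)
Definition blocksize (s : R) : nat := Num.truncn (expR (2 * s)).

Lemma blocksize_le s : (blocksize s)%:R <= expR (2 * s).
Proof. by have /andP[] := truncn_itv (expR_ge0 (2 * s)). Qed.

Lemma blocksize_ge s : 0 <= s -> (0 < blocksize s)%N /\
  1 <= 2 * (expR (- s) ^+ 2 * (blocksize s)%:R).
Proof.
move=> s0; have /andP[_ h2] := truncn_itv (expR_ge0 (2 * s)).
rewrite -/(blocksize s) in h2.
have N0 : (0 < blocksize s)%N.
  rewrite lt0n; apply/eqP => N0; move: h2; rewrite N0 ltNge => /negP; apply.
  by rewrite -expR0 ler_expR mulr_ge0.
split=> //; rewrite expRN exprVn -expRM_natl mulrCA mulrC.
rewrite ler_pdivlMr ?expR_gt0// mul1r (le_trans (ltW h2))//.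
by rewrite -[_.+1%:R]natr1 mulr_natl mulr2n lerD2l ler1n.
Qed.

(** The coefficient is [conjc (f s)] because the operator is conjugate linear and the vectors it is
    applied to carry [f s]. *)
Definition block (s : R) (N : nat) (eps : nat -> C) (x y : nat -> nat -> C) (j : nat) : C :=
  \sum_(i < N) (expR (- s))%:C * eps i * (x i j + conjc (f s) * y i j).

(* The sequences [(u k, v k)] and [(p k, q k)] are the images of the unit vectors of the
   quotient and of the subspace of the twisted sum under a bounded conjugate linear operator. *)
Definition bounded_blocks (M : R) (u v p q : nat -> nat -> C) : Prop :=
  forall s eps (kappa : nat -> nat), 1 <= s -> increasing kappa -> (forall i, cabs (eps i) <= 1) ->
  let U := block s (blocksize s) eps (u \o kappa) (p \o kappa) in
  let V := block s (blocksize s) eps (v \o kappa) (q \o kappa) in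
  l2c U M /\ l2c (fun j => V j - h (U j)) M.

Section Argument.
Variables (M : R) (u v p q : nat -> nat -> C).
Hypothesis M1 : 1 <= M.
Hypotheses (Hu : forall k, l2c (u k) M) (Hv : forall k, l2c (fun j => v k j - h (u k j)) M).
Hypothesis Hb : bounded_blocks M u v p q.

Let M0 : 0 <= M. Proof. exact: le_trans ler01 M1. Qed.

Lemma l2c_sub (x y : nat -> C) A B : l2c x A -> l2c y B -> l2c (fun j => x j - y j) (A + B).
Proof.
move=> hx hy; apply: l2_le_dom (l2_leD hx hy) => j.
by rewrite ger0_norm ?cabs_ge0// (le_trans (cabsD _ _))// cabsN.
Qed.

(** Some summand [u + conjc (f s) * p] of a block has norm at most [2 * M]. As [u] is bounded by [M]
    and [f s] has modulus [s], the norm of [p] is at most [3 * M / s]. *)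
Lemma subspace_part_small (delta : R) : 0 < delta ->
  exists k0, forall k, (k0 <= k)%N -> l2c (p k) delta.
Proof.
move=> d0; apply: eventually_of_subsequences => kappa Hk.
pose s := Num.max 1 (3 * M / delta).
have s1 : 1 <= s by rewrite le_max lexx.
have s0 : 0 < s by lra.
have sd : 3 * M <= delta * s by rewrite [leRHS]mulrC -ler_pdivrMr// le_max lexx orbT.
have [N0 cN] := blocksize_ge (ltW s0).
have [i iN Hi] := @exists_bounded_summand R (blocksize s) (expR (- s)) M
    (fun i j => u (kappa i) j + conjc (f s) * p (kappa i) j) N0 cN
    (fun eps He => (Hb s1 Hk (fun i => eq_ind_r (fun t => t <= 1) (lexx 1) (cabs_signs i He))).1).
exists i.
have H := l2c_sub Hi (Hu (kappa i)).
have sV : 0 <= s^-1 by rewrite invr_ge0 ltW.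
apply: l2_leW (l2_le_dom _ (l2_leZ sV H)).
  by rewrite mulrC ler_pdivrMr//; lra.
move=> j; rewrite ger0_norm ?cabs_ge0// addrC addKr cabsM cabsJ cabs_f gtr0_norm//.
by rewrite mulKf ?gt_eqF.
Qed.

(** Coefficients [eps] are chosen here to align the values at the coordinate [j]. If these stayed
    large, a block would have size of order [expR s] at [j], against the bound [M]. *)
Lemma quotient_part_coord_small (delta : R) j : 0 < delta ->
  exists k0, forall k, (k0 <= k)%N -> cabs (u k j) <= delta.
Proof.
move=> d0; apply: eventually_of_subsequences => kappa Hk.
apply: contrapT => nex.
have Hall i : delta < cabs (u (kappa i) j).
  by rewrite ltNge; apply/negP => hi; apply: nex; exists i.
(* The alignment will give [delta * (1 + s) <= 4 * M], which this [s] violates. *)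
pose s := 1 + 4 * M / delta.
have s1 : 1 <= s by rewrite lerDl divr_ge0 ?mulr_ge0// ltW.
have s0 : 0 < s by lra.
have [k0 Hk0] := subspace_part_small (divr_gt0 (divr_gt0 d0 s0) (ltr0n R 2)).
pose kp i := kappa (i + k0)%N.
have Hkp : increasing kp by move=> a b ab; apply: Hk; rewrite ltn_add2r.
pose a i := u (kp i) j + conjc (f s) * p (kp i) j.
have fs : cabs (conjc (f s)) = s by rewrite cabsJ cabs_f gtr0_norm.
have Ha i : delta / 2 <= cabs (a i).
  have pi_small : cabs (p (kp i) j) <= delta / s / 2.
    have /(l2_le_coord j) : l2c (p (kp i)) (delta / s / 2).
      by apply: Hk0; rewrite (leq_trans _ (increasing_ge _ Hk))// leq_addl.
    by rewrite ger0_norm ?cabs_ge0.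
  have fp : cabs (conjc (f s) * p (kp i) j) <= delta / 2.
    rewrite cabsM fs (le_trans (ler_wpM2l (ltW s0) pi_small))//.
    by rewrite le_eqVlt; apply/orP; left; apply/eqP; field; rewrite gt_eqF.
  have := Hall (i + k0)%N; rewrite -/(kp i).
  have : cabs (u (kp i) j) <= cabs (a i) + cabs (conjc (f s) * p (kp i) j).
    by rewrite -[X in cabs X <= _](addrK (conjc (f s) * p (kp i) j)) (le_trans (cabsD _ _))// cabsN.
  lra.
have a0 i : 0 < cabs (a i) by have := Ha i; lra.
pose eps i := (conjc (a i)) / (cabs (a i))%:C.
have eps1 i : cabs (eps i) <= 1.
  by rewrite cabsM cabsJ cabsV cabsR gtr0_norm// divff// gt_eqF.
have ea i : eps i * a i = (cabs (a i))%:C.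
  rewrite /eps mulrAC [_ * a i]mulrC -sqr_normc -cabsE expr2 mulfK//.
  by rewrite -(rmorph0 (real_complex R)) (inj_eq (@complexI _)) gt_eqF.
have [N0 cN] := blocksize_ge (ltW s0).
have [/(l2_le_coord j) HU _] := Hb s1 Hkp eps1.
move: HU; rewrite ger0_norm ?cabs_ge0// /block.
have -> : \sum_(i < blocksize s) (expR (- s))%:C * eps i * ((u \o kp) i j + conjc (f s) * (p \o kp) i j)
   = (expR (- s) * \sum_(i < blocksize s) cabs (a i))%:C.
  rewrite [RHS](rmorphM (real_complex R)) (rmorph_sum (real_complex R)) mulr_sumr; apply: eq_bigr => i _.
  transitivity ((expR (- s))%:C * (cabs (a i))%:C); last by [].
  by rewrite -ea mulrA.
have S1 : (blocksize s)%:R * (delta / 2) <= \sum_(i < blocksize s) cabs (a i).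
  have -> : (blocksize s)%:R * (delta / 2) = \sum_(i < blocksize s) (delta / 2).
    by rewrite sumr_const card_ord mulr_natl.
  by apply: ler_sum => i _; exact: Ha.
have e0 := expR_gt0 (- s).
rewrite cabsR ger0_norm; last first.
  by rewrite mulr_ge0 ?(ltW e0)// sumr_ge0// => i _; exact: cabs_ge0.
move=> HM.
have h1 : expR (- s) * ((blocksize s)%:R * (delta / 2)) <= M.
  by rewrite (le_trans _ HM)// ler_wpM2l// ltW.
have h2 : delta <= 4 * (expR (- s) * M).
  have := ler_wpM2l (ltW e0) h1; have := ler_wpM2r (ltW d0) cN; lra.
have es : expR (- s) * (1 + s) <= 1.
  by rewrite expRN mulrC ler_pdivrMr ?expR_gt0// mul1r expR_ge1Dx.
have h3 : delta * (1 + s) <= 4 * M.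
  have s10 : 0 <= 1 + s by lra.
  have := ler_wpM2r s10 h2; have := ler_wpM2r M0 es; lra.
have : delta * s = delta + 4 * M by rewrite /s; field; rewrite gt_eqF.
lra.
Qed.

Lemma quotient_part_head_small n (eta : R) : 0 < eta ->
  exists k0, forall k, (k0 <= k)%N -> sqs n (u k) <= eta.
Proof.
elim: n eta => [|n IH] eta eta0.
  by exists 0%N => k _; rewrite /sqs big_ord0 ltW.
have e2 : 0 < eta / 2 by rewrite divr_gt0.
have [k1 H1] := IH _ e2.
have m0 : 0 < Num.min 1 (eta / 2) by rewrite lt_min ltr01.
have [k2 H2] := quotient_part_coord_small n m0.
exists (maxn k1 k2) => k; rewrite geq_max => /andP[/H1 h1 /H2 h2].
rewrite /sqs big_ord_recr /= -/(sqs n (u k)).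
move: h2; rewrite le_min => /andP[c1 c2].
have : cabs (u k n) ^+ 2 <= cabs (u k n) by rewrite expr2 ler_piMl ?cabs_ge0.
lra.
Qed.

(** Up to small errors, the summands of [V - twist U] are [(v - h u) + resid]. The increment is kept
    only on the window [w], since only there are the [u k] disjoint. *)
Definition resid s (w : nat -> bool) (k j : nat) : C :=
  conjc (f s) * (q k j - h (p k j)) -
  (if w j then incr s (- ln (cabs (u k j))) * u k j else 0).

(** [M + 14 * L * M + 1] bounds the signed sums: [V - twist U], the multiple of [U] and the
    remaining error. Averaging doubles it, and removing [v - h u] adds [M]. *)
Definition residbound : R := 2 * (M + 14 * L * M + 1) + M.

Lemma block_estimate s kappa (w : nat -> nat -> bool) delta :
  1 <= s -> increasing kappa -> 0 <= delta ->
  (forall i i' j, w i j -> w i' j -> i = i') ->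
  (forall i, l2c (fun j => if w i j then 0 else u (kappa i) j) delta) ->
  (forall i, l2c (p (kappa i)) delta) ->
  L * (30 + 14 * (blocksize s)%:R + s) * ((blocksize s)%:R * (delta + delta)) <= 1 ->
  exists i, l2c (resid s (w i) (kappa i)) residbound.
Proof.
move=> s1 Hk d0 Hw Hud Hpd dsmall; have s0 : 0 < s := lt_le_trans ltr01 s1.
have [N0 cN] := blocksize_ge (ltW s0); set N := blocksize s in N0 cN dsmall.
pose d k j := v k j - h (u k j).
have [|i iN Hi] := @exists_bounded_summand R N (expR (- s)) (M + 14 * L * M + 1)
    (fun i j => d (kappa i) j + resid s (w i) (kappa i) j) N0 cN.
  move=> eps Heps.
  have e1 i : cabs (eps i) <= 1 by rewrite cabs_signs.
  have [HU HV] := Hb s1 Hk e1.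
  set U := block s _ eps (u \o kappa) (p \o kappa) in HU HV.
  set V := block s _ eps (v \o kappa) (q \o kappa) in HV.
  pose T j := \sum_(i < N) (cabs (if w i j then 0 else u (kappa i) j) + cabs (p (kappa i) j)).
  have K0 : 0 <= L * (30 + 14 * N%:R + s).
    by rewrite mulr_ge0// !addr_ge0 ?mulr_ge0// ltW.
  have HT : l2_le T (N%:R * (delta + delta)).
    apply: (@l2_le_sum R N (fun i j => cabs (if w i j then 0 else u (kappa i) j) + cabs (p (kappa i) j))).
      exact: addr_ge0.
    by move=> i _; apply: l2_leD.
  have L14 : 0 <= 14 * L by rewrite mulr_ge0.
  apply: l2_le_dom (l2_leD (l2_leD HV (l2_leZ L14 HU)) (l2_leW dsmall (l2_leZ K0 HT))) => j.
  rewrite ger0_norm ?cabs_ge0//.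
  have P := @twist_perturbation R alpha s N eps (fun i => u (kappa i) j)
    (fun i => p (kappa i) j) (fun i => w i j) (expR (- s))%:C (U j) s1
    (fun i => cabs_signs i Heps) (fun i i' => Hw i i' j) erefl erefl.
  set S := \sum_(i < N) _ in P.
  have -> : \sum_(i < N) (expR (- s))%:C * eps i * (d (kappa i) j + resid s (w i) (kappa i) j) =
      (V j - h (U j)) + (h (U j) - S).
    rewrite addrA subrK /V /block -/N /S -sumrB; apply: eq_bigr => i _.
    by rewrite /d /resid /=; ring.
  by rewrite (le_trans (cabsD _ _))// -addrA lerD2l.
exists i; apply: l2_le_dom (l2c_sub Hi (Hv (kappa i))) => j.
by rewrite ger0_norm ?cabs_ge0// addrC addKr.
Qed.

Lemma smallness_threshold s : 1 <= s -> exists2 delta, 0 < delta & forall d, 0 <= d <= delta ->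
  L * (30 + 14 * (blocksize s)%:R + s) * ((blocksize s)%:R * (d + d)) <= 1.
Proof.
move=> s1; have s0 : 0 < s := lt_le_trans ltr01 s1.
have [N0 _] := blocksize_ge (ltW s0); set N := blocksize s in N0 *.
have NR : 0 < N%:R :> R by rewrite ltr0n.
pose K := L * (30 + 14 * N%:R + s) * N%:R * 2.
have K0 : 0 < K.
  by rewrite !mulr_gt0// ?(lt_le_trans ltr01 L1)// !addr_gt0// mulr_gt0.
exists K^-1; first by rewrite invr_gt0.
move=> d /andP[d0 dK].
have -> : L * (30 + 14 * N%:R + s) * (N%:R * (d + d)) = K * d by rewrite /K; ring.
by rewrite -ler_pdivlMl// mulr1.
Qed.

Hypothesis alpha0 : alpha != 0.

(* The residuals at the scales [s] and [scale_ratio * s] determine [r = q - h p] wherever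
   [- ln |u|] is far from these scales, by [two_scale]. Two pairs of scales, far apart from each
   other, cover all coordinates. *)
Lemma exists_small_image (c0 : R) : 0 < c0 -> exists k,
  l2c (p k) c0 /\ l2c (fun j => q k j - h (p k j)) c0.
Proof.
move=> c00; have [eta /andP[eta0 eta1] Heta] := two_scale alpha0.
pose lam := scale_ratio alpha; have lam1 : 1 < lam := scale_ratio_gt1 alpha0.
have lam0 : 0 < lam := scale_ratio_gt0 alpha.
rewrite -/lam in Heta.
have LM0 : 0 <= L * M := mulr_ge0 L0 M0.
have M0' : 0 <= M := M0.
have B0 : 0 < residbound by rewrite /residbound; lra.
(* [ln M] ensures [- ln (cabs (u k j)) >= - s1]; the last entry makes the final bound, [2 * L / s1]
   times four residuals, at most [c0]. *)
pose s1 := Num.max (Num.max 1 (ln M)) (8 * L * residbound / c0).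
have s1_1 : 1 <= s1 by rewrite !le_max lexx.
have s1_M : ln M <= s1 by rewrite !le_max lexx orbT.
have s1_c : 8 * L * residbound <= c0 * s1 by rewrite [leRHS]mulrC -ler_pdivrMr// le_max lexx orbT.
have s1_0 : 0 < s1 := lt_le_trans ltr01 s1_1.
(* Chosen so that [eta * s2 = lam * s1 / eta]: the small range of [two_scale] for the second pair
   ends where the large range for the first pair begins. *)
pose s2 := lam * s1 / eta ^+ 2.
have e20 : 0 < eta ^+ 2 by rewrite exprn_gt0.
have etas2 : eta * s2 = lam * s1 / eta by rewrite /s2; field; rewrite gt_eqF.
have ls1 : s1 <= lam * s1 by rewrite ler_peMl// ltW.
have s12 : s1 <= eta * s2.
  by rewrite etas2 ler_pdivlMr// (le_trans _ ls1)// ler_piMr// ltW.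
have s2_0 : 0 < s2 by rewrite divr_gt0// mulr_gt0.
have s2_1 : s1 <= s2 by rewrite (le_trans s12)// ler_piMl// ltW.
have ls2 : s2 <= lam * s2 by rewrite ler_peMl// ltW.
have l1 : 1 <= lam * s1 by lra.
have s21 : 1 <= s2 by lra.
have l2 : 1 <= lam * s2 by lra.
have [d1 d10 Hd1] := smallness_threshold s1_1.
have [d2 d20 Hd2] := smallness_threshold l1.
have [d3 d30 Hd3] := smallness_threshold s21.
have [d4 d40 Hd4] := smallness_threshold l2.
pose delta := Num.min c0 (Num.min (Num.min d1 d2) (Num.min d3 d4)).
have delta0 : 0 < delta by rewrite !lt_min c00 d10 d20 d30 d40.
have dc0 : delta <= c0 by rewrite ge_min lexx.
have dd1 : 0 <= delta <= d1 by rewrite ltW// !ge_min lexx ?orbT.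
have dd2 : 0 <= delta <= d2 by rewrite ltW// !ge_min lexx ?orbT.
have dd3 : 0 <= delta <= d3 by rewrite ltW// !ge_min lexx ?orbT.
have dd4 : 0 <= delta <= d4 by rewrite ltW// !ge_min lexx ?orbT.
have [kappa [J [Hk HJ HP HW]]] := @gliding_hump R u M delta (fun k => l2c (p k) delta)
  delta0 Hu quotient_part_head_small (subspace_part_small delta0).
pose w i j := (J i <= j < J i.+1)%N.
have Jmono i i' : (i <= i')%N -> (J i <= J i')%N.
  by rewrite leq_eqVlt => /predU1P[->//|/HJ/ltnW].
have Hw i i' j : w i j -> w i' j -> i = i'.
  move=> /andP[a1 a2] /andP[b1 b2]; case: (ltngtP i i') => // ii.
    by have := leq_trans (leq_ltn_trans (leq_trans (Jmono _ _ ii) b1) a2) (leqnn _); rewrite ltnn.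
  by have := leq_trans (leq_ltn_trans (leq_trans (Jmono _ _ ii) a1) b2) (leqnn _); rewrite ltnn.
(* Windows stay disjoint along subsequences, so [block_estimate] applies to each of them. *)
have Hev s : 1 <= s ->
    L * (30 + 14 * (blocksize s)%:R + s) * ((blocksize s)%:R * (delta + delta)) <= 1 ->
    exists i0, forall i, (i0 <= i)%N -> l2c (resid s (w i) (kappa i)) residbound.
  move=> hs hd; apply: eventually_of_subsequences => k2 Hk2.
  have [|||i Hi] := @block_estimate s (kappa \o k2) (fun i => w (k2 i)) delta hs
    (increasing_comp Hk Hk2) (ltW delta0) _ _ _ hd.
  - move=> i i' j wi wi'; have := Hw _ _ _ wi wi'; case: (ltngtP i i') => // ii e.
      by have := Hk2 _ _ ii; rewrite e ltnn.
    by have := Hk2 _ _ ii; rewrite e ltnn.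
  - by move=> i; exact: HW.
  - by move=> i; exact: HP.
  - by exists i.
have [i1 Hi1] := Hev _ s1_1 (Hd1 _ dd1).
have [i2 Hi2] := Hev _ l1 (Hd2 _ dd2).
have [i3 Hi3] := Hev _ s21 (Hd3 _ dd3).
have [i4 Hi4] := Hev _ l2 (Hd4 _ dd4).
pose i := maxn (maxn i1 i2) (maxn i3 i4).
have [X1 X2] : l2c (resid s1 (w i) (kappa i)) residbound /\
    l2c (resid (lam * s1) (w i) (kappa i)) residbound.
  by split; [apply: Hi1|apply: Hi2]; rewrite !leq_max leqnn ?orbT.
have [X3 X4] : l2c (resid s2 (w i) (kappa i)) residbound /\
    l2c (resid (lam * s2) (w i) (kappa i)) residbound.
  by split; [apply: Hi3|apply: Hi4]; rewrite !leq_max leqnn ?orbT.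
exists (kappa i); split; first exact: l2_leW dc0 (HP i).
set k := kappa i in X1 X2 X3 X4 *; set w0 := w i in X1 X2 X3 X4.
have c20 : 0 <= 2 * L / s1 by rewrite divr_ge0 ?mulr_ge0// ltW.
apply: l2_leW (l2_le_dom _ (l2_leZ c20 (l2_leD (l2_leD X1 X2) (l2_leD X3 X4)))).
  rewrite mulrAC ler_pdivrMr//; lra.
move=> j; rewrite ger0_norm ?cabs_ge0//.
pose r := q k j - h (p k j); rewrite -/r.
have fs s : 0 < s -> cabs (conjc (f s)) = s by move=> ?; rewrite cabsJ cabs_f gtr0_norm.
have Y1 := cabs_ge0 (resid s1 w0 k j); have Y2 := cabs_ge0 (resid (lam * s1) w0 k j).
have Y3 := cabs_ge0 (resid s2 w0 k j); have Y4 := cabs_ge0 (resid (lam * s2) w0 k j).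
set y1 := cabs (resid s1 w0 k j) in Y1 *; set y2 := cabs (resid (lam * s1) w0 k j) in Y2 *.
set y3 := cabs (resid s2 w0 k j) in Y3 *; set y4 := cabs (resid (lam * s2) w0 k j) in Y4 *.
(* Off the window a residual is just [conjc (f s) * r]. On it, combining both residuals with
   coefficients [incr] cancels [u k j], and [two_scale] bounds the determinant [D] from below. *)
have twos s : s1 <= s ->
    (w0 j -> `|- ln (cabs (u k j))| <= eta * s \/ lam * s / eta <= - ln (cabs (u k j))) ->
    cabs r <= 2 * L / s1 * (cabs (resid s w0 k j) + cabs (resid (lam * s) w0 k j)).
  move=> hs Ht; have hs0 : 0 < s := lt_le_trans s1_0 hs.
  have hl : s <= lam * s by rewrite ler_peMl// ltW.
  have hl0 : 0 < lam * s by rewrite mulr_gt0.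
  rewrite mulrAC ler_pdivlMr//.
  have Z1 := cabs_ge0 (resid s w0 k j); have Z2 := cabs_ge0 (resid (lam * s) w0 k j).
  case: (boolP (w0 j)) => wj; last first.
    have e : cabs (resid s w0 k j) = s * cabs r.
      by rewrite /resid (negbTE wj) subr0 cabsM fs.
    have h1 : cabs r * s1 <= cabs (resid s w0 k j).
      by rewrite e mulrC ler_wpM2r ?cabs_ge0.
    have h2 : cabs (resid s w0 k j) <= 2 * L * (cabs (resid s w0 k j) + cabs (resid (lam * s) w0 k j)).
      have := ler_wpM2r (addr_ge0 Z1 Z2) L1; have := ler_wpM2r (addr_ge0 Z1 Z2) L0; lra.
    exact: le_trans h2.
  have E := Heta s (- ln (cabs (u k j))) hs0 (Ht wj).
  set t := - ln (cabs (u k j)) in E.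
  set D := _ - _ in E.
  have DE : D * r = incr (lam * s) t * resid s w0 k j - incr s t * resid (lam * s) w0 k j.
    by rewrite /D /resid wj -/r -/t; ring.
  have F1 : cabs (incr (lam * s) t) <= L * (lam * s) by apply: incr_le; exact: ltW.
  have F2 : cabs (incr s t) <= L * s by apply: incr_le; exact: ltW.
  have DL : cabs D * cabs r <= L * (lam * s) * cabs (resid s w0 k j) + L * s * cabs (resid (lam * s) w0 k j).
    rewrite -cabsM DE (le_trans (cabsD _ _))// cabsN !cabsM.
    by apply: lerD; apply: ler_wpM2r => //; exact: cabs_ge0.
  have G : s * (lam * s) * cabs r <= 2 * (L * (lam * s) * cabs (resid s w0 k j) + L * s * cabs (resid (lam * s) w0 k j)).
    have := ler_wpM2r (cabs_ge0 r) E; lra.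
  have G2 : L * s * cabs (resid (lam * s) w0 k j) <= L * (lam * s) * cabs (resid (lam * s) w0 k j).
    by apply: ler_wpM2r => //; apply: ler_wpM2l.
  have G3 : (lam * s) * (cabs r * s) <= (lam * s) * (2 * L * (cabs (resid s w0 k j) + cabs (resid (lam * s) w0 k j))).
    by lra.
  rewrite ler_pM2l// in G3; apply: le_trans G3.
  by rewrite ler_wpM2l ?cabs_ge0.
have mono a b : 0 <= a -> 0 <= b -> cabs r <= 2 * L / s1 * a -> cabs r <= 2 * L / s1 * (a + b).
  by move=> a0 b0 ra; rewrite (le_trans ra)// ler_wpM2l// lerDl.
case: (leP (- ln (cabs (u k j))) (eta * s2)) => ht.
  rewrite addrC; apply: mono; [exact: addr_ge0|exact: addr_ge0|].
  apply: twos => // wj; left; rewrite ler_norml ht andbT lerNl opprK.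
  rewrite (le_trans _ s12)//.
  have [u0|u0] := eqVneq (u k j) 0; first by rewrite u0 cabs0 ln0// ltW.
  rewrite (le_trans _ s1_M)// ler_ln ?posrE ?cabs_gt0//; last exact: lt_le_trans ltr01 M1.
  by have := l2_le_coord j (Hu k); rewrite ger0_norm ?cabs_ge0.
apply: mono; [exact: addr_ge0|exact: addr_ge0|].
by apply: twos => // wj; right; rewrite -etas2 ltW.
Qed.

End Argument.
End Blocks.

(** * Blocks of unit vectors *)

Section TestVectors.
Variables (R : realType) (alpha : R).
Local Notation C := R[i].
Local Notation f := (@f_alpha R alpha).
Local Notation h := (twist alpha).
Local Notation L := (lipc alpha).
Local Notation Zspace := (Zspace alpha).
Local Notation test := (test alpha).
Local Notation test_le := (test_le alpha).

Let L0 : 0 <= L := lipc_ge0 alpha.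
Let L1 : 1 <= L := lipc_ge1 alpha.

Definition unit_seq (m j : nat) : C := if j == m then 1 else 0.
(** Extension by zero lets a test of any length [n] act on the unit vector [m] by one formula,
    whether or not [m < n]. *)
Definition head_seq n (w : nat -> C) (j : nat) : C := if (j < n)%N then w j else 0.
Definition quot_vec m : seqpair R := (unit_seq m, fun=> 0).
Definition sub_vec m : seqpair R := (fun=> 0, unit_seq m).

Lemma sum_unit_seq n m (g : nat -> C) :
  \sum_(j < n) unit_seq m j * g j = if (m < n)%N then g m else 0.
Proof.
elim: n => [|n IH]; first by rewrite big_ord0.
rewrite big_ord_recr /= IH /unit_seq ltnS [n == m]eq_sym; case: ltngtP => [mn|mn|->].
- by rewrite mul0r addr0.
- by rewrite mul0r addr0.
- by rewrite mul1r add0r.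
Qed.

Lemma test_quot_vec n v w m :
  test n v w (quot_vec m) = head_seq n v m - h (head_seq n w m).
Proof.
rewrite testE /=; under eq_bigr do rewrite mul0r addr0.
rewrite (sum_unit_seq n m (fun j => v j - h (w j))) /head_seq.
by case: ifP => //; rewrite twist0 subr0.
Qed.

Lemma test_sub_vec n v w m : test n v w (sub_vec m) = head_seq n w m.
Proof.
rewrite testE /=; under eq_bigr do rewrite mul0r add0r.
by rewrite (sum_unit_seq n m w).
Qed.

Lemma sqs_head_seq n w m : sqs m (head_seq n w) <= sqs n w.
Proof.
suff -> : sqs m (head_seq n w) = sqs (minn m n) w by rewrite sqs_le// geq_minr.
elim: m => [|m IH]; first by rewrite min0n /sqs !big_ord0.
rewrite /sqs big_ord_recr /= -/(sqs m _) IH /head_seq; case: ltnP => mn.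
  by rewrite (minn_idPl mn) /sqs big_ord_recr.
by rewrite cabs0 expr0n addr0 (minn_idPr (leqW mn)).
Qed.

Lemma cabs_head_seq n w m : sqs n w <= 1 -> cabs (head_seq n w m) <= 1.
Proof.
move=> w1; rewrite -(@expr_le1 _ 2)// ?cabs_ge0// (le_trans _ (le_trans (sqs_head_seq n w m.+1) w1))//.
by rewrite /sqs big_ord_recr /= lerDr; exact: sqs_ge0.
Qed.

Lemma sqs_subsequence N n kappa w : increasing kappa ->
  \sum_(i < N) cabs (head_seq n w (kappa i)) ^+ 2 <= sqs n w.
Proof.
move=> Hk; apply: le_trans (sqs_head_seq n w (kappa N)).
elim: N => [|N IH]; first by rewrite big_ord0 sqs_ge0.
rewrite big_ord_recr /= (le_trans _ (sqs_le _ (Hk N N.+1 (ltnSn N))))//.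
by rewrite /sqs big_ord_recr /= lerD2r.
Qed.

Lemma test_le_quot_vec m : test_le (quot_vec m) 3.
Proof.
move=> n v w v1 w1; rewrite test_quot_vec (le_trans (cabsD _ _))// cabsN.
have hv := cabs_head_seq m v1; have hw := cabs_head_seq m w1.
have : cabs (h (head_seq n w m)) <= 2.
  rewrite /twist cabsM cabs_f normrN (le_trans (xlnx_le (cabs_ge0 _)))//.
  have : cabs (head_seq n w m) ^+ 2 <= 1 by rewrite expr_le1 ?cabs_ge0.
  lra.
lra.
Qed.

Lemma test_le_sub_vec m : test_le (sub_vec m) 1.
Proof. by move=> n v w v1 w1; rewrite test_sub_vec; exact: cabs_head_seq. Qed.

Lemma quot_vec_Zdom m : quot_vec m \in Zdom alpha.
Proof. by apply/ZdomP; exists 3; exact: test_le_quot_vec. Qed.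

Lemma sub_vec_Zdom m : sub_vec m \in Zdom alpha.
Proof. by apply/ZdomP; exists 1; exact: test_le_sub_vec. Qed.

Definition quot_unit m : Zspace := MkZspace (quot_vec_Zdom m).
Definition sub_unit m : Zspace := MkZspace (sub_vec_Zdom m).

Lemma dual_norm_sub_unit m : 1 <= dual_norm alpha (sub_unit m).
Proof.
have := test_le_coord2 m (Zspace_test (sub_unit m)).
by rewrite /= /unit_seq eqxx cabs1.
Qed.

Definition block_vec (s : R) (N : nat) (a : nat -> C) (kappa : nat -> nat) : Zspace :=
  \sum_(i < N) (a i *: quot_unit (kappa i) + (a i * f s) *: sub_unit (kappa i)).

Lemma test_block_vec s N a kappa n v w :
  test n v w (zval (block_vec s N a kappa)) =
  \sum_(i < N) a i * (head_seq n v (kappa i) +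
     (head_seq n w (kappa i) * f s - h (head_seq n w (kappa i)))).
Proof.
elim: N => [|N IH].
  rewrite /block_vec !big_ord0 testE big1// => j _.
  by rewrite zval0 /= !mul0r addr0.
have -> : block_vec s N.+1 a kappa = block_vec s N a kappa +
    (a N *: quot_unit (kappa N) + (a N * f s) *: sub_unit (kappa N)).
  by rewrite /block_vec big_ord_recr.
rewrite [RHS]big_ord_recr zvalD testD IH; congr (_ + _).
rewrite zvalD !zvalZ testD !testZ [zval (quot_unit _)]/= [zval (sub_unit _)]/=.
rewrite test_quot_vec test_sub_vec; ring.
Qed.

(* [f s] is the value prescribed by [Omega] for coefficients of size [exp (-s)]; this is what keeps
   these vectors bounded. *)
Lemma dual_norm_block_vec s N a kappa : increasing kappa -> N%:R <= expR (2 * s) ->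
  (forall i, cabs (a i) <= expR (- s)) ->
  dual_norm alpha (block_vec s N a kappa) <= 2 + 2 * L.
Proof.
move=> Hk HN Ha; apply: dual_norm_le => n v w v1 w1; rewrite test_block_vec.
set c := expR (- s) in Ha; have c0 : 0 < c := expR_gt0 _.
have Nc : N%:R * c ^+ 2 <= 1.
  by rewrite /c expRN exprVn -expRM_natl ler_pdivrMr ?expR_gt0// mul1r.
(* Since [s = - ln c], this compares [ln (cabs z)] with [ln c]; the factor [c] yields squares,
   summable because [N * c ^+ 2 <= 1]. *)
have H (z : C) : c * cabs (z * f s - h z) <= L * (c ^+ 2 + cabs z ^+ 2).
  have [->|z0] := eqVneq z 0.
    by rewrite mul0r twist0 subrr cabs0 mulr0 mulr_ge0// addr_ge0// sqr_ge0.
  have zp : 0 < cabs z by rewrite cabs_gt0.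
  rewrite /twist -mulrBr cabsM.
  have h1 : cabs (f s - f (- ln (cabs z))) <= L * `|ln (cabs z) - ln c|.
    by rewrite (le_trans (f_alpha_lip _ _ _))// /c expRK !opprK [s + _]addrC.
  rewrite (le_trans (ler_wpM2l (ltW c0) (ler_wpM2l (ltW zp) h1)))//.
  rewrite (_ : c * _ = L * (c * (cabs z * `|ln (cabs z) - ln c|))); last by ring.
  rewrite ler_wpM2l//.
  rewrite (le_trans (ler_wpM2l (ltW c0) (mul_dist_ln_le zp c0)))//.
  by rewrite mulrDr -expr2 mulrCA divff ?gt_eqF// mulr1.
have Hv (z : C) : c * cabs z <= c ^+ 2 + cabs z ^+ 2.
  by have := sqr_ge0 (c - cabs z); have := sqr_ge0 (c + cabs z); rewrite sqrrB sqrrD; lra.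
rewrite (le_trans (cabs_sum _ _ _))//.
have bnd (i : 'I_N) : cabs (a i * (head_seq n v (kappa i) +
     (head_seq n w (kappa i) * f s - h (head_seq n w (kappa i))))) <=
   (c ^+ 2 + cabs (head_seq n v (kappa i)) ^+ 2) +
   L * (c ^+ 2 + cabs (head_seq n w (kappa i)) ^+ 2).
  rewrite cabsM (le_trans (ler_pM (cabs_ge0 _) (cabs_ge0 _) (Ha i) (cabsD _ _)))//.
  by rewrite mulrDr lerD.
rewrite (le_trans (ler_sum _ (fun i _ => bnd i)))// big_split /= -mulr_sumr !big_split /=.
rewrite sumr_const card_ord -mulr_natl.
have sv := le_trans (sqs_subsequence N n v Hk) v1.
have sw := le_trans (sqs_subsequence N n w Hk) w1.
have : L * (N%:R * c ^+ 2 + \sum_(i < N) cabs (head_seq n w (kappa i)) ^+ 2) <= L * 2.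
  by rewrite ler_wpM2l//; lra.
lra.
Qed.

End TestVectors.

(** * The identity of the twisted sum and the two ideals *)

Section Factorization.
Variables (R : realType) (alpha : R).
Local Notation C := R[i].
Local Notation f := (@f_alpha R alpha).
Local Notation h := (twist alpha).
Local Notation L := (lipc alpha).
Local Notation Zspace := (Zspace alpha).
Local Notation l2c x M := (l2_le (fun j => cabs (x j)) M).

Let L0 : 0 <= L := lipc_ge0 alpha.

(** The operator bounds in [factors_Z] are complex numbers; the order of [C] compares real parts,
    which yields a real bound. *)
Lemma real_bound (N d : R) (M : C) : 0 <= d -> N%:C <= M * d%:C -> N <= `|complex.Re M| * d.
Proof.
move=> d0; rewrite lecE => /andP[_ /=].
case: M => a b /=; rewrite mulr0 subr0 => H.
by rewrite (le_trans H)// ler_wpM2r// ler_norm.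
Qed.

Lemma id_in_C_alpha : in_C_alpha alpha (@idfun Zspace).
Proof.
(* [B] must be defined on all pairs of sequences; [insubd] sends those outside [Zdom] to 0. *)
have BE (z : seqpair R) : in_Z alpha z -> zval (insubd (0 : Zspace) z) = z.
  move=> zZ; apply: insubdK; apply/ZdomP; eexists; exact: test_le_Znorm zZ.
exists (fun x : Zspace => zval x), (fun z => insubd 0 z); split.
- by move=> x; have [] := test_le_in_Z (Zspace_test x).
- by move=> a x y; rewrite zvalD zvalZ.
- exists (2 + 2 * L)%:C => x; rewrite ZnormE -rmorphM lecR.
  by have [] := test_le_in_Z (Zspace_test x).
split.
- move=> a z w zZ wZ; apply: val_inj.
  rewrite [LHS]insubdK; last first.
    have -> : pair_add (pair_scale a z) w = a *: z + w by [].
    apply: rpredD; [apply: rpredZ|]; apply/ZdomP; eexists; exact: test_le_Znorm.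
  by rewrite [RHS]zvalD zvalZ !BE.
- exists (1 + 2 * L)%:C => z zZ; rewrite ZnormE -rmorphM lecR.
  by apply: dual_norm_le; rewrite BE//; exact: test_le_Znorm.
- by move=> x; rewrite valKd.
Qed.

Hypothesis alpha0 : alpha != 0.

Lemma id_notin_conj_C_alpha : ~ in_conj_C_alpha alpha (@idfun Zspace).
Proof.
move=> [A [B [HA Hlin [MA HMA] [_ [MB HMB] HBA]]]].
have Ac (a : C) (x y : Zspace) : A (a *: x + y) = pair_add (pair_scale (conjc a) (A x)) (A y).
  by rewrite -Hlin /tw conjcK.
have A0 : A 0 = (fun=> 0, fun=> 0).
  have := Ac (-1) 0 0; rewrite scaler0 addr0 => e; rewrite [LHS]e.
  have cN1 : conjc (-1 : C) = -1 by apply/eqP; rewrite eq_complex /= !oppr0 !eqxx.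
  congr (_, _); apply/funext => k.
    by transitivity (conjc (-1) * (A 0).1 k + (A 0).1 k); rewrite // cN1 mulN1r addNr.
  by transitivity (conjc (-1) * (A 0).2 k + (A 0).2 k); rewrite // cN1 mulN1r addNr.
pose KA := `|complex.Re MA|; pose KB := `|complex.Re MB|.
have bA (x : Zspace) : Znorm alpha (A x) <= KA * dual_norm alpha x.
  have hx := HMA x; rewrite ZnormE in hx.
  exact: (real_bound (dual_norm_ge0 x) hx).
have Asum s N a kappa : A (block_vec alpha s N a kappa) =
   ((fun j => \sum_(i < N) conjc (a i) * ((A (quot_unit alpha (kappa i))).1 j + conjc (f s) * (A (sub_unit alpha (kappa i))).1 j)),
    (fun j => \sum_(i < N) conjc (a i) * ((A (quot_unit alpha (kappa i))).2 j + conjc (f s) * (A (sub_unit alpha (kappa i))).2 j))).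
  elim: N => [|N IH].
    rewrite /block_vec big_ord0 A0; congr (_, _); apply/funext => j; by rewrite big_ord0.
  have -> : block_vec alpha s N.+1 a kappa = a N *: quot_unit alpha (kappa N) +
      ((a N * f s) *: sub_unit alpha (kappa N) + block_vec alpha s N a kappa).
    by rewrite /block_vec big_ord_recr [RHS]addrA [RHS]addrC.
  have E (x y S : C) : conjc (a N) * x + (conjc (a N * f s) * y + S) =
      S + conjc (a N) * (x + conjc (f s) * y).
    by rewrite conjcM; ring.
  by rewrite Ac Ac IH; congr (_, _); apply/funext => j; rewrite big_ord_recr; exact: E.
(* [3 + 2 * L] covers the bounds 3 and 1 for the two kinds of unit vectors and [2 + 2 * L] for the
   blocks. *)
pose K1 := KA * (3 + 2 * L).
have K10 : 0 <= K1.
  by apply: mulr_ge0; [exact: normr_ge0|apply: addr_ge0 => //; exact: mulr_ge0].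
pose M := 1 + K1 + L * (1 + K1 ^+ 2).
have LK0 : 0 <= L * (1 + K1 ^+ 2) by apply: mulr_ge0 => //; apply: addr_ge0 => //; exact: sqr_ge0.
have M1 : 1 <= M by rewrite /M; lra.
have bound (x : Zspace) : dual_norm alpha x <= 3 + 2 * L ->
    l2c (A x).1 M /\ l2c (fun j => (A x).2 j - h ((A x).1 j)) M.
  move=> xd; have xK : Znorm alpha (A x) <= K1.
    by apply: le_trans (bA x) _; apply: ler_wpM2l => //; exact: normr_ge0.
  have [h1 h2] := l2_le_Znorm (HA x) xK.
  by split; [apply: l2_leW h1|apply: l2_leW h2]; rewrite /M; lra.
have bq k : dual_norm alpha (quot_unit alpha k) <= 3 + 2 * L.
  have : dual_norm alpha (quot_unit alpha k) <= 3 by apply: dual_norm_le; exact: test_le_quot_vec.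
  have := L0; lra.
have bs k : dual_norm alpha (sub_unit alpha k) <= 3 + 2 * L.
  have : dual_norm alpha (sub_unit alpha k) <= 1 by apply: dual_norm_le; exact: test_le_sub_vec.
  have := L0; lra.
pose u k := (A (quot_unit alpha k)).1; pose v k := (A (quot_unit alpha k)).2.
pose p k := (A (sub_unit alpha k)).1; pose q k := (A (sub_unit alpha k)).2.
have Hb : bounded_blocks alpha M u v p q.
  move=> s eps kappa s1 Hk Heps U V.
  (* Conjugated beforehand, so that [A] restores [eps i]. *)
  pose a i := (expR (- s))%:C * conjc (eps i).
  have ca i : conjc (a i) = (expR (- s))%:C * eps i by rewrite /a conjcM conjc_real conjcK.
  have da : dual_norm alpha (block_vec alpha s (blocksize s) a kappa) <= 3 + 2 * L.
    rewrite (le_trans (dual_norm_block_vec alpha Hk (blocksize_le s) _))//; last by have := L0; lra.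
    by move=> i; rewrite /a cabsM cabsJ cabsR gtr0_norm ?expR_gt0// ler_piMr ?expR_ge0.
  have [] := bound _ da; rewrite Asum /=.
  have UE j : \sum_(i < blocksize s) conjc (a i) * (u (kappa i) j + conjc (f s) * p (kappa i) j) = U j.
    by apply: eq_bigr => i _; rewrite ca.
  have VE j : \sum_(i < blocksize s) conjc (a i) * (v (kappa i) j + conjc (f s) * q (kappa i) j) = V j.
    by apply: eq_bigr => i _; rewrite ca.
  under eq_fun do rewrite UE.
  move=> h1; under eq_fun do rewrite UE VE.
  by split.
(* Then [KB * eta <= 1 / 2], while [B] must return a vector of norm at least 1. *)
pose eta := (2 * (1 + KB))^-1.
have KB0 : 0 <= KB by exact: normr_ge0.
have eta0 : 0 < eta by rewrite invr_gt0 mulr_gt0// ltr_pwDl.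
have [c c0 Hc] := Znorm_small alpha eta0.
have [k [Hp Hq]] := exists_small_image M1 (fun k => (bound _ (bq k)).1)
  (fun k => (bound _ (bq k)).2) Hb alpha0 c0.
have small : Znorm alpha (A (sub_unit alpha k)) <= eta by exact: Hc.
have N0 : 0 <= Znorm alpha (A (sub_unit alpha k)) by rewrite addr_ge0 ?l2norm_ge0.
have hB := HMB _ (HA (sub_unit alpha k)); rewrite -HBA ZnormE in hB.
have h1 := real_bound N0 hB.
have h2 := dual_norm_sub_unit alpha k.
have h3 : KB * Znorm alpha (A (sub_unit alpha k)) <= KB * eta by rewrite ler_wpM2l.
have h4 : KB * eta <= 1 / 2.
  by rewrite /eta ler_pdivrMr ?mulr_gt0 ?ltr_pwDl//; lra.
have : 1 <= 1 / 2 :> R := le_trans h2 (le_trans h1 (le_trans h3 h4)).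
by rewrite ler_pdivlMr// mul1r lern1.
Qed.

End Factorization.

Theorem mainTheorem2 (R : realType) (alpha : R) (halpha : alpha != 0) :
  ~ (forall (X Y : completeNormedModType R[i]) (T : X -> Y),
        bounded_linear T ->
        (in_C_alpha alpha T <-> in_conj_C_alpha alpha T)).
Proof.
move=> H; apply: (id_notin_conj_C_alpha halpha).
apply: (H (Zspace alpha) (Zspace alpha) idfun _).1; last exact: id_in_C_alpha.
split=> //; exists 1 => x; by rewrite mul1r.
Qed.
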